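(* Let $\gamma$ be a penalty function satisfying the standing assumptions (A0)–(A3) of the context, and let $f:\Omega\times\mathbb{R}\to(-\infty,\infty]$ be a proper normal convex integrand. Suppose that there exists $\eta_0\in L^{\rho_\gamma}$ with $f^*(\cdot,\eta_0)^+\in L^{\rho_\gamma}$, and that there exists $\xi_0\in L^\infty$ with $f(\cdot,\xi_0)^+\in M^{\rho_\gamma}_u$. Then for any $\nu\in ba$ with Yosida–Hewitt decomposition $\nu=\nu_r+\nu_s$, $$\mathcal{H}_{f^*,\gamma}(\nu_r)+\sup_{\xi\in\mathcal{D}_{f,\gamma}}\nu_s(\xi)\;\le\;\mathcal{I}_{f,\gamma}^*(\nu)\;\le\;\mathcal{H}_{f^*,\gamma}(\nu_r)+\sup_{\xi\in\mathrm{dom}(\mathcal{I}_{f,\gamma})}\nu_s(\xi),$$ where $\mathcal{D}_{f,\gamma}:=\{\xi\in L^\infty:\ f(\cdot,\xi)^+\in M^{\rho_\gamma}_u\}\subset\mathrm{dom}(\mathcal{I}_{f,\gamma})$.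
   Context: **Probability space.** $(\Omega,\mathcal{F},\mathbb{P})$ is a complete probability space; $L^0$ is the space of ($\mathbb{P}$-a.s. classes of) real random variables and $L^p=L^p(\Omega,\mathcal{F},\mathbb{P})$. ''A.s.'' and identification of random variables always refer to $\mathbb{P}$; $\mathbb{E}$ is $\mathbb{P}$-expectation, $\mathbb{E}_Q$ is $Q$-expectation. $\mathcal{Q}$ is the set of probability measures $Q\ll\mathbb{P}$ on $\mathcal{F}$, identified with $\{\eta\in L^1:\eta\ge0,\ \mathbb{E}[\eta]=1\}$ via $Q\mapsto dQ/d\mathbb{P}$. For $Q\in\mathcal{Q}$, $L^1(Q)=\{\xi\in L^0:\mathbb{E}_Q[|\xi|]<\infty\}$. **Finitely additive measures.** $ba$ is the norm dual of $L^\infty$: bounded finitely additive signed measures on $\mathcal{F}$ vanishing on $\mathbb{P}$-null sets, with $\nu(\xi)=\int_\Omega\xi\,d\nu$. $\sigma$-additive elements of $ba$ are identified with $L^1$ via $\nu\mapsto d\nu/d\mathbb{P}$. $\nu$ is purely finitely additive (singular) if there are $A_n\in\mathcal{F}$ with $\mathbb{P}(A_n)\nearrow1$ and $|\nu|(A_n)=0$ for all $n$. Every $\nu\in ba$ has a unique Yosida–Hewitt decomposition $\nu=\nu_r+\nu_s$ with $\nu_r$ $\sigma$-additive and $\nu_s$ purely finitely additive. **Penalty function.** $\gamma:\mathcal{Q}\to[0,\infty]$ satisfies: (A0) $\gamma$ is proper, convex and $\sigma(L^1,L^\infty)$-lower semicontinuous; (A1) $\inf_{Q\in\mathcal{Q}}\gamma(Q)=0$;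 (A2) there is $Q_0\in\mathcal{Q}$ with $Q_0\sim\mathbb{P}$ and $\gamma(Q_0)<\infty$; (A3) $\{Q\in\mathcal{Q}:\gamma(Q)\le1\}$ is $\sigma(L^1,L^\infty)$-compact. $\mathcal{Q}_\gamma:=\{Q\in\mathcal{Q}:\gamma(Q)<\infty\}$. Set $\rho_\gamma(\xi):=\sup_{Q\in\mathcal{Q}_\gamma}(\mathbb{E}_Q[\xi]-\gamma(Q))$ for $\xi\in L^0$ with $\xi^-\in\bigcap_{Q\in\mathcal{Q}_\gamma}L^1(Q)$, and $$L^{\rho_\gamma}=\{\xi\in L^0:\exists\alpha>0,\ \rho_\gamma(\alpha|\xi|)<\infty\},$$ $$M^{\rho_\gamma}=\{\xi\in L^0:\forall\alpha>0,\ \rho_\gamma(\alpha|\xi|)<\infty\},$$ $$M^{\rho_\gamma}_u=\{\xi\in L^0:\forall\alpha>0,\ \lim_{N\to\infty}\rho_\gamma(\alpha|\xi|\mathbf{1}_{\{|\xi|>N\}})=0\}.$$ **Integrand and functionals.** $f$ is a proper normal convex integrand: $f$ is $\mathcal{F}\otimes\mathcal{B}(\mathbb{R})$-measurable and $f(\omega,\cdot)$ is a lower semicontinuous proper convex function for a.e. $\omega$. $f(\cdot,\xi)$ denotes $\omega\mapsto f(\omega,\xi(\omega))$, and $f^*(\omega,y):=\sup_{x\in\mathbb{R}}(xy-f(\omega,x))$. For $\xi\in L^\infty$, $$\mathcal{I}_{f,\gamma}(\xi):=\sup_{Q\in\mathcal{Q}_\gamma}(\mathbb{E}_Q[f(\cdot,\xi)]-\gamma(Q)),\qquad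 \mathrm{dom}(\mathcal{I}_{f,\gamma})=\{\xi\in L^\infty:\mathcal{I}_{f,\gamma}(\xi)<\infty\},$$ and $\mathcal{I}_{f,\gamma}^*(\nu):=\sup_{\xi\in L^\infty}(\nu(\xi)-\mathcal{I}_{f,\gamma}(\xi))$ for $\nu\in ba$. With $\mathrm{dom}f(\omega,\cdot)=\{x:f(\omega,x)<\infty\}$, set for $y\in\mathbb{R}$, $z\ge0$ $$\tilde f^*(\omega,y,z):=\sup_{x\in\mathrm{dom}f(\omega,\cdot)}(xy-zf(\omega,x)).$$ For $\eta\in L^1$, $Q\in\mathcal{Q}_\gamma$: $\mathcal{H}_{f^*}(\eta|Q):=\mathbb{E}[\tilde f^*(\cdot,\eta,dQ/d\mathbb{P})]$ and $\mathcal{H}_{f^*,\gamma}(\eta):=\inf_{Q\in\mathcal{Q}_\gamma}(\mathcal{H}_{f^*}(\eta|Q)+\gamma(Q))$; for $\sigma$-additive $\nu\in ba$, $\mathcal{H}_{f^*,\gamma}(\nu):=\mathcal{H}_{f^*,\gamma}(d\nu/d\mathbb{P})$. *)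

(* Defs.v *)
From HB Require Import structures.
From mathcomp Require Import all_boot all_order all_algebra.
From mathcomp Require Import all_classical all_reals all_analysis.
From mathcomp Require Import measurable_realfun.

Set Implicit Arguments.
Unset Strict Implicit.
Unset Printing Implicit Defensive.

Import Order.TTheory GRing.Theory Num.Theory.
Import numFieldNormedType.Exports.

Local Open Scope classical_set_scope.
Local Open Scope ring_scope.
Local Open Scope ereal_scope.
Local Open Scope charge_scope.

Section finitely_additive.
Context d (T : measurableType d) (R : realType) (P : probability T R).

(* Functions, not classes; everything below only depends on a.s. classes. *)
Definition Linfty := LfunType P (leey 1 : (1 <= +oo :> \bar R)).

(* The norm dual of L^oo: [nu xi] is the integral of [xi] with respect to [nu].
   The bound makes [nu xi] depend only on the a.s. class of [xi]. *)
Record ba := Ba {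
  ba_fun :> {scalar Linfty} ;
  ba_bounded : exists C : R, forall xi : Linfty,
    `|ba_fun xi|%:E <= C%:E * 'N[P]_+oo[EFin \o xi] }.

(* The set function A |-> nu(1_A); the default 0 of [insubd] is only reached
   when A is not measurable. *)
Definition ba_set (nu : ba) (A : set T) : R := nu (insubd 0%R (\1_A : T -> R)).

Definition ba_variation (nu : ba) (A : set T) : \bar R :=
  ereal_sup [set y | exists n (F : 'I_n -> set T),
    [/\ forall i, measurable (F i), trivIset [set: 'I_n] F,
        \bigcup_i F i = A & y = (\sum_(i < n) `|ba_set nu (F i)|)%R%:E]].

Definition ba_sigma_additive (nu : ba) : Prop :=
  semi_sigma_additive (fun A => (ba_set nu A)%:E).

Definition purely_finitely_additive (nu : ba) : Prop :=
  exists A : (set T)^nat, [/\ forall n, measurable (A n),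
    {homo P \o A : m n / (m <= n)%N >-> m <= n},
    P (A n) @[n --> \oo] --> 1 & forall n, ba_variation nu (A n) = 0].

Definition yosida_hewitt (nu nur nus : ba) : Prop :=
  [/\ forall xi : Linfty, nu xi = (nur xi + nus xi)%R,
      ba_sigma_additive nur & purely_finitely_additive nus].

Section charge_of_ba.
Variables (nu : ba) (snu : ba_sigma_additive nu).

Definition charge_of_ba of ba_sigma_additive nu : set T -> \bar R :=
  fun A => (ba_set nu A)%:E.

Let charge_of_ba0 : charge_of_ba snu set0 = 0.
Proof.
rewrite /charge_of_ba /ba_set indic0.
rewrite (_ : insubd _ _ = 0%R) ?raddf0//.
by rewrite -[X in insubd _ X]/(val (0%R : Linfty)) valKd.
Qed.

Let charge_of_ba_fin A : measurable A -> charge_of_ba snu A \is a fin_num.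
Proof. by []. Qed.

HB.instance Definition _ := isCharge.Build d T R (charge_of_ba snu)
  charge_of_ba0 charge_of_ba_fin snu.

Definition ba_density : T -> R :=
  fun w => fine (('d (charge_of_ba snu) '/d P) w).

End charge_of_ba.

End finitely_additive.

Section penalty.
Context d (T : measurableType d) (R : realType) (P : probability T R).

Record acprobability := AcProbability {
  acprob :> probability T R ;
  acprob_dominates : acprob `<< P }.

HB.instance Definition _ := gen_eqMixin acprobability.
HB.instance Definition _ := gen_choiceMixin acprobability.

Definition density (Q : acprobability) : T -> R :=
  fun w => fine (('d (charge_of_finite_measure Q) '/d P) w).

(* The topology sigma(L^1, L^oo) on densities: the coarsest one making
   Q |-> E[xi dQ/dP] continuous for every xi in L^oo. Measures that agree on
   measurable sets are topologically indistinguishable, so that a lower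
   semicontinuous penalty does not separate them. *)
Definition pairing (Q : acprobability) : prod_topology (fun _ : Linfty P => R) :=
  fun xi => (\int[P]_w (xi w * density Q w))%R.

Definition weak_acprobability : topologicalType := initial_topology pairing.

Implicit Types gamma : acprobability -> \bar R.

Definition convex_penalty gamma : Prop :=
  forall (Q0 Q1 Q : acprobability) (t : R), (0 <= t <= 1)%R ->
  (forall A, measurable A -> Q A = t%:E * Q0 A + (1 - t)%:E * Q1 A) ->
  gamma Q <= t%:E * gamma Q0 + (1 - t)%:E * gamma Q1.

Record is_penalty gamma : Prop := IsPenalty {
  penalty_ge0 : forall Q, 0 <= gamma Q ;
  penalty_proper : exists Q, gamma Q < +oo ;
  penalty_convex : convex_penalty gamma ;
  penalty_lsc : lower_semicontinuous (gamma : weak_acprobability -> \bar R) ;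
  penalty_inf : ereal_inf (range gamma) = 0 ;
  penalty_equiv : exists Q0 : acprobability, P `<< Q0 /\ gamma Q0 < +oo ;
  penalty_compact : compact ([set Q | gamma Q <= 1] : set weak_acprobability) }.

Definition dom_penalty gamma : set acprobability := [set Q | gamma Q < +oo].

Definition rho gamma (X : T -> \bar R) : \bar R :=
  ereal_sup [set \int[Q]_w X w - gamma Q | Q in dom_penalty gamma].

(* L^0 and the spaces below are stated for extended real-valued functions so
   that they apply to f(., xi)^+, which is a random variable once it is a.s.
   finite. *)
Definition L0 (X : T -> \bar R) : Prop :=
  measurable_fun setT X /\ {ae P, forall w, X w \is a fin_num}.

Definition Lrho gamma (X : T -> \bar R) : Prop :=
  L0 X /\ exists2 a : R, (0 < a)%R & rho gamma (fun w => a%:E * `|X w|) < +oo.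

Definition Mrhou gamma (X : T -> \bar R) : Prop :=
  L0 X /\ forall a : R, (0 < a)%R ->
    rho gamma (fun w => a%:E * `|X w| *
      (\1_[set v | (N%:R%:E < `|X v|)%E] w)%:E) @[N --> \oo] --> 0.

End penalty.

Section integrand.
Context d (T : measurableType d) (R : realType) (P : probability T R).

(* With 0 * +oo = 0, the cases t = 0 and t = 1 are trivial; no oo - oo arises
   for functions that avoid -oo. *)
Definition convex_efun (g : R -> \bar R) : Prop :=
  forall (x y t : R), (0 <= t <= 1)%R ->
  g (t * x + (1 - t) * y)%R <= t%:E * g x + (1 - t)%:E * g y.

Record normal_convex_integrand (f : T -> R -> \bar R) : Prop :=
  NormalConvexIntegrand {
  integrand_gtNy : forall w x, -oo < f w x ;
  integrand_measurable :
    measurable_fun [set: T * R] (fun p : T * R => f p.1 p.2) ;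
  integrand_proper : {ae P, forall w, exists x, f w x < +oo} ;
  integrand_convex : {ae P, forall w, convex_efun (f w)} ;
  integrand_lsc : {ae P, forall w, lower_semicontinuous (f w)} }.

Implicit Types (f : T -> R -> \bar R) (gamma : acprobability P -> \bar R).

Definition conjugate f (w : T) (y : R) : \bar R :=
  ereal_sup (range (fun x : R => (x * y)%:E - f w x)).

(* At z = 0 this is the support function of dom f(w, .): without the restriction
   to the domain, the convention 0 * +oo = 0 would give the one of R. *)
Definition conjugate_tilde f (w : T) (y z : R) : \bar R :=
  ereal_sup [set (x * y)%:E - z%:E * f w x | x in [set x | f w x < +oo]].

Definition robust_integral gamma f (xi : Linfty P) : \bar R :=
  rho gamma (fun w => f w (xi w)).

Definition dom_robust gamma f : set (Linfty P) :=
  [set xi | robust_integral gamma f xi < +oo].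

Definition robust_conjugate gamma f (nu : ba P) : \bar R :=
  ereal_sup (range (fun xi : Linfty P =>
    (nu xi)%:E - robust_integral gamma f xi)).

Definition f_divergence f (eta : T -> R) (Q : acprobability P) : \bar R :=
  \int[P]_w conjugate_tilde f w (eta w) (density Q w).

Definition robust_f_divergence gamma f (eta : T -> R) : \bar R :=
  ereal_inf [set f_divergence f eta Q + gamma Q | Q in dom_penalty gamma].

Definition Drobust gamma f : set (Linfty P) :=
  [set xi | Mrhou gamma ((fun w => f w (xi w))^\+)].

End integrand.

(* Main.v *)
Require Import Defs.
From HB Require Import structures.
From mathcomp Require Import all_boot all_order all_algebra.
From mathcomp Require Import all_classical all_reals all_analysis.
From mathcomp Require Import measurable_realfun ess_sup_inf finmap.
From mathcomp Require Import ring lra.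

(** Write [F(xi, Q) = nu(xi) - E_Q[f(xi)] + gamma(Q)] for the payoff. The
    conjugate of the robust integral is a supremum over [xi] of an infimum
    over [Q] of [F], and the entropy bounds come from exchanging the two.

    The upper bound is Young's inequality: pointwise [xi eta - f(xi) dQ/dP
    <= conjugate_tilde f eta (dQ/dP)], and integrating bounds [F(xi, Q) -
    nus(xi)] by the divergence of [Q] plus its penalty, whatever [Q] is
    ([integral_gain_le], [robust_conjugate_le]).

    The lower bound needs the minimax equality, on the set [Drobust gamma
    f]. There the tails of [f(xi)^+] are integrable uniformly in [Q], up to
    a multiple of [1 + gamma(Q)] ([Mrhou_tail]); truncating [f(xi)] shows
    that [F(xi, .)] is weakly lower semicontinuous on each sublevel set of
    [gamma] ([integral_usc]), and these sublevel sets are compact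
    ([compact_sublevel]). The minimax theorem itself ([minimax_compact]) is
    elementary: compactness leaves finitely many [xi], and these are merged
    two at a time, using only concavity in [xi] and convexity in [Q].

    It is essential to apply the minimax theorem to [nu] itself and not to
    its regular part. After the exchange, [Q] is fixed, so that a single
    integrable density governs all limits, and it remains to make [F(., Q)]
    large:

    - a sequence of elements of [Drobust], selected among [xi0] and the
      rational constants, increases the integrand [xi eta - f(xi) dQ/dP] to
      its pointwise supremum, which is [conjugate_tilde]; monotone
      convergence then yields the divergence ([conjugate_tildeE],
      [f_divergence_approx]);
    - the singular part vanishes on sets of probability close to one, so
      changing the selected element into any given [zeta] off such a set
      adds [nus(zeta)] at an arbitrarily small cost ([paste_approx]). *)

Set Implicit Arguments.
Unset Strict Implicit.
Unset Printing Implicit Defensive.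

Import Order.TTheory GRing.Theory Num.Theory.
Import numFieldNormedType.Exports.

Local Open Scope classical_set_scope.
Local Open Scope ring_scope.

(** * A minimax theorem on compact sets *)

Section minimax.
Context {R : realType}.

(** A weight [t < 1] works if and only if its slope [r = t / (1 - t)] lies
    above every [(c - g2 y) / (g1 y - c)] with [g2 y < c] and below every [(g2
    x - c) / (c - g1 x)] with [g1 x < c]. If two of these bounds were in the
    wrong order, a mixture of [x] and [y] would have both values at most [c].
    *)
Lemma minimax_pair (X : Type) (K : set X) (g1 g2 : X -> R) (c : R) :
  (forall x y (t : R), K x -> K y -> 0 <= t <= 1 -> exists2 z, K z &
     g1 z <= t * g1 x + (1 - t) * g1 y /\ g2 z <= t * g2 x + (1 - t) * g2 y) ->
  (forall x, K x -> c < g1 x \/ c < g2 x) ->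
  exists2 t : R, 0 <= t <= 1 &
    forall x, K x -> c <= t * g1 x + (1 - t) * g2 x.
Proof.
move=> Kconv Kmax.
have cross x y : K x -> K y -> g1 x < c -> g2 y < c ->
    (c - g2 y) * (c - g1 x) <= (g2 x - c) * (g1 y - c).
  move=> Kx Ky g1x g2y.
  have g1y : c < g1 y by case: (Kmax _ Ky) => //; lra.
  have g2x : c < g2 x by case: (Kmax _ Kx) => //; lra.
  rewrite leNgt; apply/negP => lt.
  pose a := c - g1 x; pose a' := g1 y - c.
  have a0 : 0 < a by rewrite /a; lra.
  have a'0 : 0 < a' by rewrite /a'; lra.
  (* at this weight the bound on [g1 z] is exactly [c] *)
  pose s := a' / (a + a').
  have aa'0 : 0 < a + a' by lra.
  have sE : s * (a + a') = a' by rewrite /s mulfVK// gt_eqF.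
  have s01 : 0 <= s <= 1.
    rewrite /s divr_ge0 ?(ltW a'0) ?(ltW aa'0)//= ler_pdivrMr//.
    by rewrite mul1r lerDr ltW.
  have [z Kz [g1z g2z]] := Kconv x y s Kx Ky s01.
  have : (g1 z <= c) /\ (g2 z <= c).
    split.
      apply: (le_trans g1z); rewrite -subr_ge0.
      suff -> : c - (s * g1 x + (1 - s) * g1 y) = s * (a + a') - a'.
        by rewrite sE subrr.
      by rewrite /a /a'; ring.
    apply: (le_trans g2z); rewrite -(ler_pM2l aa'0).
    rewrite -subr_ge0.
    suff -> : (a + a') * c - (a + a') * (s * g2 x + (1 - s) * g2 y) =
       (c - g2 y) * (a + a') - (s * (a + a')) * (g2 x - g2 y).
      by rewrite sE /a /a'; move: lt; rewrite -subr_gt0 => lt; nra.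
    by ring.
  by case: (Kmax _ Kz); lra.
have [[x0 [Kx0 g1x0]]|no1] := pselect (exists x, K x /\ g1 x < c); last first.
  exists 1; first by rewrite ler01 lexx.
  move=> x Kx; rewrite subrr mul0r addr0 mul1r leNgt; apply/negP => ?.
  by apply: no1; exists x.
have [[y0 [Ky0 g2y0]]|no2] := pselect (exists x, K x /\ g2 x < c); last first.
  exists 0; first by rewrite ler01 lexx.
  move=> x Kx; rewrite subr0 mul0r add0r mul1r leNgt; apply/negP => ?.
  by apply: no2; exists x.
(* the lower bounds on the slope *)
pose E := [set (c - g2 y) / (g1 y - c) | y in [set y | K y /\ g2 y < c]].
have ubE x : K x -> g1 x < c -> ubound E ((g2 x - c) / (c - g1 x)).
  move=> Kx g1x _ [y [Ky g2y] <-].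
  have g1y : c < g1 y by case: (Kmax _ Ky) => //; lra.
  rewrite ler_pdivrMr ?subr_gt0// mulrAC ler_pdivlMr ?subr_gt0//.
  exact: cross.
have supE : has_sup E.
  by split; [exists ((c - g2 y0) / (g1 y0 - c)), y0|exists ((g2 x0 - c) / (c -
    g1 x0)); exact: ubE].
pose r := sup E.
have r0 : 0 <= r.
  have g1y : c < g1 y0 by case: (Kmax _ Ky0) => //; lra.
  apply: (@le_trans _ _ ((c - g2 y0) / (g1 y0 - c))).
    by rewrite divr_ge0; lra.
  by apply: ub_le_sup => //; [case: supE|exists y0].
exists (r / (1 + r)).
  rewrite divr_ge0 ?addr_ge0//= ler_pdivrMr ?mul1r ?lerDr//.
  by rewrite ltr_wpDr.
move=> x Kx.
have r1 : 0 < 1 + r by rewrite ltr_wpDr.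
have -> : r / (1 + r) * g1 x + (1 - r / (1 + r)) * g2 x =
    (r * g1 x + g2 x) / (1 + r) by field; rewrite gt_eqF.
rewrite ler_pdivlMr//.
suff : 0 <= r * (g1 x - c) + (g2 x - c) by nra.
have [g1x|g1x] := ltP (g1 x) c.
  have : r <= (g2 x - c) / (c - g1 x).
    by apply: ge_sup; [case: supE|exact: ubE].
  rewrite ler_pdivlMr ?subr_gt0//; lra.
have [g2x|g2x] := ltP (g2 x) c; last first.
  by apply: addr_ge0; rewrite ?mulr_ge0 ?subr_ge0.
have {}g1x : c < g1 x by case: (Kmax _ Kx) => //; lra.
have : (c - g2 x) / (g1 x - c) <= r.
  by apply: ub_le_sup => //; [case: supE|exists x].
by rewrite ler_pdivrMr ?subr_gt0//; lra.
Qed.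

Section convexlike.
Variables (X : Type) (I : choiceType) (D : set I) (F : I -> X -> R).

(** Fan's notions: a convex combination of two values only has to be dominated
    by the value at some third point, so that neither the points nor the
    indices carry a linear structure. *)
Definition convexlike (K : set X) := forall x y (t : R), K x -> K y
  -> 0 <= t <= 1 ->
  exists2 z, K z & forall i, D i -> F i z <= t * F i x + (1 - t) * F i y.

Definition concavelike (K : set X) := forall i j (t : R), D i -> D j
  -> 0 <= t <= 1 ->
  exists2 k, D k & forall x, K x -> t * F i x + (1 - t) * F j x <= F k x.

(** Where the first index has value at most [c], some other index exceeds [c];
    that set is again convexlike, so by induction a single index serves there,
    and [minimax_pair] merges it with the first one. The loss from [c] to [c']
    turns the weak inequality of each merge into a strict one for the next. *)
Lemma minimax_seq (K : set X) (s : seq I) (i0 : I) (c' c : R) :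
  convexlike K -> concavelike K -> D i0 -> (forall i, i \in s -> D i) ->
  c' < c -> (forall x, K x -> exists2 i, i \in s & c < F i x) ->
  exists2 i, D i & forall x, K x -> c' <= F i x.
Proof.
elim: s K c' c => [|j s ih] K c' c Kconv Kconc Di0 sD c'c Ks.
  by exists i0 => // x /Ks[].
have Dj : D j by apply: sD; rewrite mem_head.
pose K1 := K `&` [set x | F j x <= c].
have [||||||k Dk K1k] := ih K1 ((c' + c) / 2) c.
- move=> x y t [Kx xc] [Ky yc] t01; have [z Kz zF] := Kconv x y t Kx Ky t01.
  exists z => //; split => //=; apply: (le_trans (zF _ Dj)).
  by rewrite /= in xc yc; nra.
- move=> i i' t Di Di' /(Kconc _ _ _ Di Di')[k Dk kF].
  by exists k => // x [Kx _]; exact: kF.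
- exact: Di0.
- by move=> i si; apply: sD; rewrite inE si orbT.
- by lra.
- move=> x [Kx xc]; have [i] := Ks x Kx.
  rewrite inE => /orP[/eqP ->|]; last by exists i.
  by move=> xc'; move: xc; rewrite /= leNgt xc'.
have [||t t01 tK] := @minimax_pair X K (F k) (F j) c'.
- move=> x y t Kx Ky t01; have [z Kz zF] := Kconv x y t Kx Ky t01.
  by exists z => //; split; exact: zF.
- move=> x Kx; have [xc|xc] := leP (F j x) c; last by right; lra.
  by left; apply: lt_le_trans (K1k x _) => //; lra.
have [l Dl lF] := Kconc k j t Dk Dj t01.
by exists l => // x Kx; exact: le_trans (tK x Kx) (lF x Kx).
Qed.

End convexlike.

(** The index [i0] confines the problem to the compact set [C], where
    semicontinuity reduces it to finitely many indices. *)
Lemma minimax_compact (Y : topologicalType) (I : choiceType) (D : set I)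
    (F : I -> Y -> R) (K C : set Y) (i0 : I) (c' c : R) :
  convexlike D F K -> concavelike D F K -> D i0 ->
  compact C -> [set x | K x /\ F i0 x <= c] `<=` C -> C `<=` K ->
  (forall i x, D i -> C x -> c < F i x ->
    nbhs x [set y | C y -> c < F i y]) ->
  (forall x, K x -> exists2 i, D i & c < F i x) ->
  c' < c ->
  exists2 i, D i & forall x, K x -> c' <= F i x.
Proof.
move=> Kconv Kconc Di0 Cc subC CK lsc Ksup c'c.
suff [s sD Cs] : exists2 s : seq I, (forall i, i \in s -> D i) &
    forall x, C x -> exists2 i, i \in s & c < F i x.
  apply: (@minimax_seq Y I D F K (i0 :: s) i0 c' c) => //.
  - by move=> i; rewrite inE => /orP[/eqP ->//|/sD].
  - move=> x Kx; have [xc|xc] := leP (F i0 x) c.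
      have [//|i si ic] := Cs x (subC _ _).
      by exists i => //; rewrite inE si orbT.
    by exists i0 => //; exact: mem_head.
apply: contrapT => nfin.
pose f i := C `&` [set x | F i x <= c].
have fI : finI D f.
  move=> D' D'D.
  have [x [Cx xD']] : exists x, C x /\ forall i, i \in D' -> F i x <= c.
    apply: contrapT => nx; apply: nfin; exists (enum_fset D').
      by move=> i /D'D /set_mem.
    move=> x Cx; apply: contrapT => ni; apply: nx; exists x; split => // i iD'.
    by rewrite leNgt; apply/negP => ic; apply: ni; exists i.
  by exists x => i iD'; split => //; exact: xD'.
have [|x [Cx xF]] := Cc _ (finI_filter fI).
  exists (f i0); last by move=> x [].
  exact: finI_from1.
have [i Di ic] := Ksup x (CK _ Cx).
have [y [[Cy yc]] /(_ Cy)/=] : f i `&` [set y | C y -> c < F i y] !=set0.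
  apply: xF; last exact: lsc.
  by exists (f i) => //; exact: finI_from1.
by rewrite /= ltNge yc.
Qed.

End minimax.

(** * Bounded functions and finitely additive measures *)

Local Open Scope ereal_scope.
Local Open Scope charge_scope.

Section integral_comparison.
Context d (T : measurableType d) (R : realType).
Variable mu : {measure set T -> \bar R}.

(** Under the convention [+oo - +oo = -oo], subtraction is monotone in both the
    integral of the positive part and that of the negative part. *)
Lemma ae_le_integral (X Y : T -> \bar R) :
  measurable_fun setT X -> measurable_fun setT Y ->
  {ae mu, forall w, X w <= Y w} -> \int[mu]_w X w <= \int[mu]_w Y w.
Proof.
move=> mX mY XY; rewrite integralE [leRHS]integralE leeB//.
  apply: ae_ge0_le_integral => //; [exact: measurable_funepos..|].
  apply: filterS XY => w XYw _; rewrite !funeposE.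
  by rewrite ge_max le_max XYw /= le_max lexx orbT.
apply: ae_ge0_le_integral => //; [exact: measurable_funeneg..|].
apply: filterS XY => w XYw _; rewrite !funenegE.
by rewrite ge_max !le_max leeN2 XYw /= lexx orbT.
Qed.

Lemma ae_le_integrable (X Y : T -> \bar R) :
  measurable_fun setT X -> mu.-integrable setT Y ->
  {ae mu, forall w, `|X w| <= Y w} -> mu.-integrable setT X.
Proof.
move=> mX /integrableP[mY Yoo] XY; apply/integrableP; split => //.
apply: le_lt_trans Yoo; apply: ae_le_integral; try exact: measurableT_comp.
by apply: filterS XY => w XYw; rewrite (le_trans XYw)// lee_abs.
Qed.

End integral_comparison.

Section Linfty_functions.
Context d (T : measurableType d) (R : realType) (P : probability T R).

Lemma Linfty_bounded (xi : Linfty P) :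
  exists2 M : R, (0 <= M)%R & {ae P, forall w, (`|xi w| <= M)%R}.
Proof.
have : 'N[P]_+oo[EFin \o xi] < +oo by exact: (Lfunction_finite _ xi).
rewrite unlock /=. rewrite probability_setT lte01.
case E : (ess_sup _ _) => [r| |]//= _.
  exists (Num.max r 0%R); first by rewrite le_max lexx orbT.
  have := ess_sup_ge P (abse \o (EFin \o xi)); rewrite E.
  by apply: filterS => w /=; rewrite lee_fin => h; rewrite le_max h.
exists 0%R => //.
have := ess_sup_ge P (abse \o (EFin \o xi)); rewrite E.
by apply: filterS => w /=.
Qed.

Lemma Lnormoo_le (g : T -> R) (M : R) : (0 <= M)%R ->
  {ae P, forall w, (`|g w| <= M)%R} -> 'N[P]_+oo[EFin \o g] <= M%:E.
Proof.
move=> M0 gM; rewrite unlock /= probability_setT lte01.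
by apply/ess_supP; apply: filterS gM => w /=; rewrite lee_fin.
Qed.

(** The default [0] of [insubd] is only reached outside of [L^oo]. *)
Definition toLinfty (g : T -> R) : Linfty P := insubd 0%R g.

Lemma toLinftyE (g : T -> R) (M : R) : measurable_fun setT g ->
  {ae P, forall w, (`|g w| <= M)%R} -> toLinfty g = g :> (T -> R).
Proof.
move=> mg gM; rewrite /toLinfty.
have gP : g \in Lfun P +oo.
  rewrite inE; apply/andP; split; first exact: mem_set.
  apply: mem_set; rewrite /= /finite_norm.
  apply: (@le_lt_trans _ _ (Num.max M 0%R)%:E); last exact: ltry.
  apply: Lnormoo_le; first by rewrite le_max lexx orbT.
  by apply: filterS gM => w h; rewrite le_max h.
exact: (insubdK (0%R : Linfty P) gP).
Qed.

Lemma LinftyDE (xi zeta : Linfty P) w : (xi + zeta)%R w = (xi w + zeta w)%R.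
Proof. by []. Qed.

Lemma LinftyBE (xi zeta : Linfty P) w : (xi - zeta)%R w = (xi w - zeta w)%R.
Proof. by []. Qed.

Lemma LinftyZE (a : R) (xi : Linfty P) w : (a *: xi)%R w = (a * xi w)%R.
Proof. by []. Qed.

Lemma Linfty_ext (xi zeta : Linfty P) :
  (forall w, xi w = zeta w :> R) -> xi = zeta.
Proof. by move=> h; apply/LfuneqP. Qed.

Lemma indic_LinftyE (A : set T) : measurable A ->
  toLinfty \1_A = \1_A :> (T -> R).
Proof.
move=> mA; apply: (@toLinftyE _ 1%R).
  exact: measurable_indic.
by apply: nearW => w; rewrite indicE; case: (w \in A); rewrite ?normr1 ?normr0.
Qed.

Lemma measurable_mem (A : set T) : measurable A ->
  measurable_fun setT (fun w => w \in A).
Proof.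
by move=> mA; apply: (measurable_fun_bool true);
  rewrite setTI preimage_mem_true.
Qed.

Definition paste (A : set T) (xi zeta : Linfty P) : Linfty P :=
  toLinfty (fun w => if w \in A then xi w else zeta w).

Lemma pasteE (A : set T) (xi zeta : Linfty P) w : measurable A ->
  paste A xi zeta w = if w \in A then xi w else zeta w.
Proof.
move=> mA; have [M M0 xiM] := Linfty_bounded xi.
have [N N0 zetaN] := Linfty_bounded zeta.
rewrite /paste (@toLinftyE _ (M + N)%R)//.
  apply: measurable_fun_ifT => //; exact: measurable_mem.
apply: filterS2 xiM zetaN => v h1 h2; case: ifP => _.
  by rewrite (le_trans h1)// lerDl.
by rewrite (le_trans h2)// lerDr.
Qed.

Definition Linfty_linear (l : Linfty P -> R) :=
  forall a xi zeta, l (a *: xi + zeta)%R = (a * l xi + l zeta)%R.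

(** Subtracting [(M/2) 1_{xi >= 0} - (M/2) 1_{xi < 0}] from [xi], which does
    not change [l xi], halves the bound [M] on [|xi|]; iterate. *)
Lemma bounded_linear_eq0 (l : Linfty P -> R) (C : R) : Linfty_linear l ->
  (forall (xi : Linfty P) (M : R), (0 <= M)%R
    -> {ae P, forall w, (`|xi w| <= M)%R} ->
     (`|l xi| <= C * M)%R) ->
  (forall A, measurable A -> l (toLinfty \1_A) = 0%R) ->
  forall xi, l xi = 0%R.
Proof.
move=> lin bnd l0.
have halve n : forall (xi : Linfty P) (M : R), (0 <= M)%R ->
    {ae P, forall w, (`|xi w| <= M)%R} -> (`|l xi| * 2 ^+ n <= C * M)%R.
  elim: n => [|n ih] xi M M0 xiM; first by rewrite expr0 mulr1; exact: bnd.
  pose A := [set w | (0 <= xi w)%R].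
  have mA : measurable A.
    rewrite [A](_ : _ = xi @^-1` `[0%R, +oo[).
      by rewrite -[X in measurable X]setTI; exact: measurable_funP.
    by apply/seteqP; split => w; rewrite /A /= in_itv/= andbT.
  pose zeta := ((- (M / 2)) *: toLinfty \1_A + ((M / 2) *: toLinfty \1_(~` A) +
    xi))%R.
  have lz : l zeta = l xi.
    by rewrite /zeta !lin !l0 ?mulr0 ?add0r//; exact: measurableC.
  have zM : {ae P, forall w, (`|zeta w| <= M / 2)%R}.
    apply: filterS xiM => w;
      rewrite /zeta !LinftyDE !LinftyZE !indic_LinftyE//;
        last exact: measurableC.
    rewrite !indicE in_setC /A.
    have [x0|x0] := boolP (w \in _); rewrite /= ?mulr1 ?mulr0 ?add0r.
      move/set_mem: x0 => /= x0; rewrite !ler_norml => /andP[? ?].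
      by apply/andP; split; lra.
    have {}x0 : (xi w < 0)%R.
      by rewrite ltNge; apply/negP => x1; move/negP: x0; apply; exact: mem_set.
    by rewrite !ler_norml => /andP[? ?]; apply/andP; split; lra.
  have := ih zeta (M / 2)%R (divr_ge0 M0 (ler0n _ _)) zM.
  by rewrite lz exprS; lra.
move=> xi; have [M M0 xiM] := Linfty_bounded xi.
apply/eqP; rewrite -normr_le0 leNgt; apply/negP => l_gt0.
have := @upper_nthrootP R (C * M / `|l xi|) _ (leqnn _).
rewrite ltr_pdivrMr// ltNge => /negP; apply.
by rewrite mulrC; exact: halve.
Qed.

Lemma ba_le (nu : ba P) : exists2 C : R, (0 <= C)%R &
  forall (xi : Linfty P) (M : R), (0 <= M)%R ->
    {ae P, forall w, (`|xi w| <= M)%R} -> (`|nu xi| <= C * M)%R.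
Proof.
have [C nuC] := ba_bounded nu; exists `|C|%R => // xi M M0 xiM.
rewrite -lee_fin (le_trans (nuC _))// EFinM.
apply: (@le_trans _ _ (`|C|%:E * 'N[P]_+oo[EFin \o xi])).
  by rewrite lee_wpmul2r ?Lnorm_ge0// lee_fin ler_norm.
by rewrite lee_wpmul2l ?lee_fin// Lnormoo_le.
Qed.

Lemma ba_linear (nu : ba P) : Linfty_linear nu.
Proof. by move=> a xi zeta; rewrite linearP. Qed.

Lemma ba_setE (nu : ba P) A : ba_set nu A = nu (toLinfty \1_A).
Proof. by []. Qed.

(** The pieces [B `&` A] and [A `\` B] partition [A]. *)
Lemma ba_variation0_indic (nu : ba P) (A B : set T) :
  measurable A -> measurable B -> ba_variation nu A = 0 ->
  nu (toLinfty \1_(B `&` A)) = 0%R.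
Proof.
move=> mA mB nuA; rewrite -ba_setE.
have : (`|ba_set nu (B `&` A)| + `|ba_set nu (A `\` B)|)%:E <= ba_variation nu
  A.
  apply: ereal_sup_ubound; exists 2%N.
  exists (fun i : 'I_2 => if i == ord0 then B `&` A else A `\` B); split.
  - by move=> i; case: ifP => _; [exact: measurableI|exact: measurableD].
  - apply/trivIsetP => i j _ _ ij; apply/seteqP; split => w //=.
    case: (eqVneq i ord0) => i0; case: (eqVneq j ord0) => j0.
    + by rewrite i0 j0 eqxx in ij.
    + by move=> [[? ?] [? ?]].
    + by move=> [[? ?] [? ?]].
    + move: ij i0 j0; case: i => -[|[|//]] ?; case: j => -[|[|//]] ?;
      by rewrite -!val_eqE.
  - apply/seteqP; split => w.
      by move=> [i _]; case: ifP => _ [].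
    move=> Aw; have [Bw|Bw] := pselect (B w); first by exists ord0.
    by exists ord_max.
  - by rewrite !big_ord_recl big_ord0 /= addr0.
rewrite nuA lee_fin => h; apply/eqP; rewrite -normr_le0.
by apply: le_trans h; rewrite lerDl.
Qed.

(** [x |-> nu (x 1_A)] is bounded, linear and zero on indicators, so zero. *)
Lemma ba_variation0_paste (nu : ba P) (A : set T) (xi zeta : Linfty P) :
  measurable A -> ba_variation nu A = 0 -> nu (paste A xi zeta) = nu zeta.
Proof.
move=> mA nuA; have [C C0 nuC] := ba_le nu.
pose l x := nu (paste A x 0%R).
have pasteD (a : R) (x y : Linfty P) :
      paste A (a *: x + y)%R 0%R = (a *: paste A x 0 + paste A y 0)%R.
  apply: Linfty_ext => w; rewrite pasteE// [in RHS]LinftyDE LinftyZE !pasteE//.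
  by case: ifP => _ //; rewrite mulr0 addr0.
have l0 x : l x = 0%R.
  apply: (@bounded_linear_eq0 l C) => //.
  - by move=> a y z; rewrite /l pasteD ba_linear.
  - move=> y M M0 yM; apply: nuC => //; apply: filterS yM => w.
    by rewrite pasteE//; case: ifP => // _ _; rewrite normr0.
  - move=> B mB; rewrite /l.
    suff -> : paste A (toLinfty \1_B) 0%R = toLinfty \1_(B `&` A).
      exact: ba_variation0_indic.
    apply: Linfty_ext => w; rewrite pasteE// !indic_LinftyE//;
      last exact: measurableI.
    by rewrite !indicE in_setI; case: (w \in A); rewrite ?andbT ?andbF.
have -> : paste A xi zeta = (1%R *: paste A (xi - zeta) 0 + zeta)%R.
  apply: Linfty_ext => w;
    rewrite pasteE// [in RHS]LinftyDE LinftyZE mul1r !pasteE//.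
  by case: ifP => _; rewrite ?LinftyBE ?subrK ?add0r.
by rewrite ba_linear mul1r -/(l (xi - zeta)%R) l0 add0r.
Qed.

Lemma ba_dominates (nu : ba P) (snu : ba_sigma_additive nu) :
  charge_of_ba snu `<< P.
Proof.
apply/null_content_dominatesP => A mA PA.
rewrite /charge_of_ba ba_setE; have [C C0 nuC] := ba_le nu.
suff: (`|nu (toLinfty \1_A)| <= C * 0)%R.
  by rewrite mulr0 normr_le0 => /eqP ->.
apply: nuC => //; exists A; split => // w /=.
rewrite indic_LinftyE// indicE; have [/set_mem//|_] := boolP (w \in A).
by rewrite normr0 => /(_ (lexx _)).
Qed.

Lemma integrable_ba_density (nu : ba P) (snu : ba_sigma_additive nu) :
  P.-integrable setT (EFin \o ba_density snu).
Proof.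
have nuP := ba_dominates snu.
apply: (@eq_integrable _ _ _ _ _ measurableT ('d (charge_of_ba snu) '/d P)).
  by move=> w _; rewrite /= fineK//; exact: Radon_Nikodym_fin_num.
exact: Radon_Nikodym_integrable.
Qed.

Lemma integrable_Linfty_mul (xi : Linfty P) (eta : T -> R) :
  P.-integrable setT (EFin \o eta) ->
  P.-integrable setT (fun w => (xi w * eta w)%:E).
Proof.
move=> ieta; have [M M0 xiM] := Linfty_bounded xi.
have /measurable_EFinP meta := measurable_int _ ieta.
apply: (@ae_le_integrable _ _ _ _ _ (fun w => M%:E * `|(eta w)%:E|)).
- by apply/measurable_EFinP; exact: measurable_funM.
- by apply: integrableZl => //; exact: integrable_abse.
- apply: filterS xiM => w h; rewrite /= -EFinM lee_fin normrM.
  exact: ler_wpM2r.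
Qed.

(** Both sides are bounded and linear in [xi], and agree on indicators by the
    Radon-Nikodym theorem. *)
Lemma ba_sigma_additiveE (nu : ba P) (snu : ba_sigma_additive nu)
    (xi : Linfty P) :
  (nu xi)%:E = \int[P]_w (xi w * ba_density snu w)%:E.
Proof.
set eta := ba_density snu; have ieta := integrable_ba_density snu.
have fin x : \int[P]_w ((x : Linfty P) w * eta w)%:E \is a fin_num.
  by apply: integrable_fin_num => //; exact: integrable_Linfty_mul.
pose l x := (nu x - fine (\int[P]_w ((x : Linfty P) w * eta w)%:E))%R.
suff : l xi = 0%R by move=> /subr0_eq ->; rewrite fineK.
have [C C0 nuC] := ba_le nu.
apply: (@bounded_linear_eq0 l (C + fine (\int[P]_w `|(eta w)%:E|))%R).
- move=> a x y; rewrite /l ba_linear.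
  have -> : \int[P]_w ((a *: x + y)%R w * eta w)%:E =
      a%:E * \int[P]_w (x w * eta w)%:E + \int[P]_w (y w * eta w)%:E.
    rewrite -integralZl//; last exact: integrable_Linfty_mul.
    rewrite -integralD//; last 2 first.
    - by apply: integrableZl => //; exact: integrable_Linfty_mul.
    - exact: integrable_Linfty_mul.
    apply: eq_integral => w _; rewrite LinftyDE LinftyZE mulrDl EFinD.
    by rewrite -mulrA EFinM.
  by rewrite fineD ?fin_numM// fineM//=; ring.
- move=> x M M0 xM; rewrite /l (le_trans (ler_normB _ _))// mulrDl.
  rewrite lerD//; first exact: nuC.
  rewrite -lee_fin EFinM fineK; last first.
    by apply: integrable_fin_num => //; exact: integrable_abse.
  rewrite -fine_abse// fineK ?abse_fin_num//.
  apply: (le_trans (le_abse_integral _ _ _)) => //.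
    by case/integrableP : (integrable_Linfty_mul x ieta).
  rewrite muleC -integralZl//; last exact: integrable_abse.
  apply: ae_le_integral.
  + apply: measurableT_comp => //.
    by case/integrableP : (integrable_Linfty_mul x ieta).
  + apply: emeasurable_funM => //; apply: measurableT_comp => //.
    exact: measurable_int ieta.
  + apply: filterS xM => w h; rewrite /= -EFinM lee_fin normrM.
    exact: ler_wpM2r.
- move=> A mA; rewrite /l.
  suff -> : \int[P]_w ((toLinfty \1_A : Linfty P) w * eta w)%:E =
      (nu (toLinfty \1_A))%:E by rewrite subrr.
  rewrite indic_LinftyE//.
  transitivity (\int[P]_(w in A) ('d (charge_of_ba snu) '/d P) w).
    rewrite [RHS]integral_mkcond; apply: eq_integral => w _.
    rewrite patchE indicE; case: ifP => _; rewrite ?mul0r// mul1r /eta.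
    by rewrite /ba_density fineK//;
      exact: Radon_Nikodym_fin_num (ba_dominates snu).
  by rewrite -Radon_Nikodym_integral//; exact: ba_dominates.
Qed.

End Linfty_functions.

(** * Absolutely continuous probabilities and their densities *)

Section acprobability_theory.
Context d (T : measurableType d) (R : realType) (P : probability T R).
Implicit Types Q : acprobability P.

Lemma ac_ae Q (A : T -> Prop) : {ae P, forall w, A w} -> {ae Q, forall w, A w}.
Proof.
move=> [N [mN PN AN]]; exists N; split => //.
by have /null_content_dominatesP := acprob_dominates Q; apply.
Qed.

Lemma density_RN Q w :
  (density Q w)%:E = ('d (charge_of_finite_measure Q) '/d P) w.
Proof. 
by rewrite fineK//; apply: Radon_Nikodym_fin_num; exact: acprob_dominates. Qed.

Lemma integrable_density Q : P.-integrable setT (EFin \o density Q).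
Proof.
apply: (@eq_integrable _ _ _ _ _ measurableT
  ('d (charge_of_finite_measure Q) '/d P)).
  by move=> w _; rewrite -density_RN.
by apply: Radon_Nikodym_integrable; exact: acprob_dominates.
Qed.

Lemma measurable_density Q : measurable_fun setT (density Q).
Proof. by apply/measurable_EFinP;
  exact: measurable_int (integrable_density Q). Qed.

Lemma density_ge0 Q : {ae P, forall w, (0 <= density Q w)%R}.
Proof.
have := ae_eq_Radon_Nikodym_SigmaFinite (acprob_dominates Q) (@measurableT _ T).
apply: filterS => w /(_ I) E; rewrite -lee_fin density_RN -E.
exact: Radon_Nikodym_SigmaFinite.f_ge0 (acprob_dominates Q) _.
Qed.

Lemma integral_density Q (X : T -> \bar R) : Q.-integrable setT X ->
  \int[P]_w (X w * (density Q w)%:E) = \int[Q]_w X w.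
Proof.
move=> iX; under eq_integral do rewrite density_RN.
exact: (Radon_Nikodym_change_of_variables (acprob_dominates Q)).
Qed.

Lemma integrable_mul_density Q (X : T -> \bar R) : Q.-integrable setT X ->
  P.-integrable setT (fun w => X w * (density Q w)%:E).
Proof.
move=> iX; apply/integrableP; split.
  apply: emeasurable_funM; first exact: measurable_int iX.
  by apply/measurable_EFinP; exact: measurable_density.
apply: (@le_lt_trans _ _ (\int[P]_w (`|X w| * (density Q w)%:E))).
  apply: ae_le_integral.
  - apply: measurableT_comp => //; apply: emeasurable_funM;
    first exact: measurable_int iX.
    by apply/measurable_EFinP; exact: measurable_density.
  - apply: emeasurable_funM.
      by apply: measurableT_comp => //; exact: measurable_int iX.
    by apply/measurable_EFinP; exact: measurable_density.
  - apply: filterS (density_ge0 Q) => w h.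
    by rewrite abseM (@gee0_abs _ (density Q w)%:E)// lee_fin.
rewrite (@integral_density Q (fun w => `|X w|)); last exact: integrable_abse.
by case/integrableP : iX.
Qed.

Lemma integrable_Linfty Q (xi : Linfty P) : Q.-integrable setT (EFin \o xi).
Proof.
have [M M0 xiM] := Linfty_bounded xi.
apply: (@ae_le_integrable _ _ _ _ _ (cst M%:E)).
- exact/measurable_EFinP.
- exact: finite_measure_integrable_cst.
- by apply: filterS (ac_ae Q xiM) => w; rewrite /= lee_fin.
Qed.

Lemma pairingE Q (xi : Linfty P) :
  (pairing Q xi)%:E = \int[Q]_w (xi w)%:E.
Proof.
rewrite -(@integral_density Q (EFin \o xi)); last exact: integrable_Linfty.
rewrite /pairing /Rintegral fineK//=.
apply: integrable_fin_num => //.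
exact: (integrable_mul_density (integrable_Linfty Q xi)).
Qed.

(** An equation between values on measurable sets, since measures with the same
    such values need not be equal as elements of [acprobability P]. *)
Definition mixture (Q Q0 Q1 : acprobability P) (t : R) :=
  forall A, measurable A -> Q A = t%:E * Q0 A + (1 - t)%:E * Q1 A.

(** The weights may have any sign, so that a mixture can also be undone. *)
Lemma affine_acprobability (Q0 Q1 : acprobability P) (t : R) :
  (forall A, measurable A -> 0 <= t%:E * Q0 A + (1 - t)%:E * Q1 A) ->
  exists Q, mixture Q Q0 Q1 t.
Proof.
move=> ge0.
pose nu : {charge set T -> \bar R} :=
  crestr0 (cadd (cscale t (charge_of_finite_measure Q0))
                (cscale (1 - t) (charge_of_finite_measure Q1)))
    (@measurableT _ T).
have nuE A : measurable A -> nu A = t%:E * Q0 A + (1 - t)%:E * Q1 A.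
  by move=> mA; rewrite /nu /= /crestr0 mem_set// /crestr setIT.
have nu0 A : 0 <= nu A.
  have [mA|nmA] := pselect (measurable A); first by rewrite nuE// ge0.
  by rewrite /nu /= /crestr0 memNset.
have mT : measure_of_charge nu nu0 setT = 1.
  rewrite /measure_of_charge nuE// !probability_setT !mule1 -EFinD.
  by rewrite addrC subrK.
pose mix := Measure_isProbability.Build _ _ _ (measure_of_charge nu nu0) mT.
pose Q' : probability T R := HB.pack (measure_of_charge nu nu0) mix.
have Q'P : Q' `<< P.
  apply/null_content_dominatesP => A mA PA.
  change (nu A = 0).
  rewrite nuE//.
  have /null_content_dominatesP /(_ A mA PA) -> := acprob_dominates Q0.
  have /null_content_dominatesP /(_ A mA PA) -> := acprob_dominates Q1.
  by rewrite !mule0 adde0.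
exists (AcProbability Q'P) => A mA.
exact: nuE.
Qed.

Section mixture.
Variables (Q Q0 Q1 : acprobability P) (t : R).
Hypotheses (t01 : (0 <= t <= 1)%R) (Qt : mixture Q Q0 Q1 t).

Lemma ge0_integral_mixture (X : T -> \bar R) :
  measurable_fun setT X -> (forall w, 0 <= X w) ->
  \int[Q]_w X w = t%:E * \int[Q0]_w X w + (1 - t)%:E * \int[Q1]_w X w.
Proof.
move=> mX X0; have /andP[t0 t1] := t01.
have t1' : (0 <= 1 - t)%R by rewrite subr_ge0.
pose m := measure_add (mscale (NngNum t0) Q0) (mscale (NngNum t1') Q1).
rewrite (eq_measure_integral m).
  by rewrite ge0_integral_measure_add// !ge0_integral_mscale.
move=> A mA _; apply: (eq_trans (Qt mA)).
by rewrite /m /= /msum 2!big_ord_recl big_ord0 adde0.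
Qed.

Lemma integral_mixture (X : T -> \bar R) :
  Q0.-integrable setT X -> Q1.-integrable setT X ->
  \int[Q]_w X w = t%:E * \int[Q0]_w X w + (1 - t)%:E * \int[Q1]_w X w.
Proof.
move=> i0 i1; have /integrableP[mX _] := i0.
rewrite integralE [\int[Q0]_w _]integralE [\int[Q1]_w _]integralE.
rewrite !ge0_integral_mixture//;
  [|exact: measurable_funeneg|exact: measurable_funepos].
have /fineK <- := integrable_pos_fin_num measurableT i0.
have /fineK <- := integrable_neg_fin_num measurableT i0.
have /fineK <- := integrable_pos_fin_num measurableT i1.
have /fineK <- := integrable_neg_fin_num measurableT i1.
by rewrite -!EFinB -!EFinM -EFinD; congr EFin; ring.
Qed.

End mixture.

Lemma mixture_exists (Q0 Q1 : acprobability P) (t : R) : (0 <= t <= 1)%R ->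
  exists Q, mixture Q Q0 Q1 t.
Proof.
move=> t01; apply: affine_acprobability => A _.
have /andP[t0 t1] := t01.
by rewrite adde_ge0// mule_ge0// lee_fin ?subr_ge0.
Qed.

End acprobability_theory.

(** * Uniform integrability relative to the penalty *)

Section penalty_theory.
Context d (T : measurableType d) (R : realType) (P : probability T R).
Variable gamma : acprobability P -> \bar R.
Hypothesis gammaP : is_penalty gamma.
Implicit Types (Q : acprobability P) (X Y : T -> \bar R).
Local Notation dom := (dom_penalty gamma).

Lemma penalty_fin_num Q : dom Q -> gamma Q \is a fin_num.
Proof. by move=> Qoo; rewrite ge0_fin_numE//; exact: (penalty_ge0 gammaP). Qed.

Lemma fine_penalty_ge0 Q : (0 <= fine (gamma Q))%R.
Proof. by apply: fine_ge0; exact: (penalty_ge0 gammaP). Qed.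

Lemma rho_ge X Q : dom Q -> \int[Q]_w X w - gamma Q <= rho gamma X.
Proof. by move=> Qoo; apply: ereal_sup_ubound; exists Q. Qed.

Lemma integral_le_rho X Q : dom Q -> \int[Q]_w X w <= rho gamma X + gamma Q.
Proof.
by move=> Qoo; rewrite -leeBlDr ?penalty_fin_num//; exact: rho_ge.
Qed.

(** Measures of small penalty make [rho] nonnegative on nonnegative functions,
    and one of them is the fixed measure of [compact_sublevel]. *)
Lemma small_penalty (e : R) : (0 < e)%R -> exists2 Q, dom Q & gamma Q < e%:E.
Proof.
move=> e0; have [|_ [Q _ <-]] := @lb_ereal_inf_adherent R (range gamma) e e0.
  by rewrite (penalty_inf gammaP).
rewrite (penalty_inf gammaP) add0e => Qe; exists Q => //.
exact: lt_trans Qe (ltry _).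
Qed.

Lemma rho_ge0 X : (forall w, 0 <= X w) -> 0 <= rho gamma X.
Proof.
move=> X0; apply/lee_addgt0Pr => e e0.
have [Q Qoo Qe] := small_penalty e0.
have : 0 <= \int[Q]_w X w by exact: integral_ge0.
move=> /le_trans; apply; apply: (le_trans (integral_le_rho X Qoo)).
by rewrite leeD2l// ltW.
Qed.

Lemma Lrho_integrable X Q : dom Q -> Lrho gamma X -> Q.-integrable setT X.
Proof.
move=> Qoo [[mX _] [a a0 aX]]; apply/integrableP; split => //.
have : \int[Q]_w (a%:E * `|X w|) < +oo.
  apply: le_lt_trans (integral_le_rho _ Qoo) _.
  by rewrite lte_add_pinfty.
rewrite ge0_integralZl_EFin//; [|exact: measurableT_comp|exact: ltW].
case: (\int[Q]_w `|X w|) => [r _| |//]; first exact: ltry.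
by rewrite gt0_muley ?lte_fin.
Qed.

(** Compared with [X 1_{X > N}], the excess is monotone in [X]. *)
Definition excess X (N : nat) : T -> \bar R := (fun w => X w - N%:R%:E)^\+.

(** Uniform integrability of [X^+] on each sublevel set of the penalty, with an
    error that is at most linear in the penalty. *)
Definition tail_controlled X := forall e : R, (0 < e)%R -> exists N : nat,
  forall Q, dom Q -> \int[Q]_w excess X N w <= e%:E * (1 + gamma Q).

Lemma excessE X N w : excess X N w = maxe (X w - N%:R%:E) 0.
Proof. by rewrite /excess funeposE. Qed.

Lemma excess_ge0 X N w : 0 <= excess X N w.
Proof. exact: funepos_ge0. Qed.

Lemma measurable_excess X N :
  measurable_fun setT X -> measurable_fun setT (excess X N).
Proof.
by move=> mX; apply: measurable_funepos; exact: emeasurable_funB.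
Qed.

Lemma le_excess X N M w : (M <= N)%N -> excess X N w <= excess X M w.
Proof.
move=> MN; rewrite !excessE ge_max !le_max lexx orbT andbT leeB ?orTb//.
by rewrite lee_fin ler_nat.
Qed.

(** The excess of a maximum is at most the sum of the two excesses. *)
Lemma tail_controlled_le_max X X1 X2 : measurable_fun setT X ->
  measurable_fun setT X1 -> measurable_fun setT X2 ->
  {ae P, forall w, X w <= maxe (X1 w) (X2 w)} ->
  tail_controlled X1 -> tail_controlled X2 -> tail_controlled X.
Proof.
move=> mX mX1 mX2 XX t1 t2 e e0.
have e20 : (0 < e / 2)%R by rewrite divr_gt0.
have [N1 X1N] := t1 _ e20; have [N2 X2N] := t2 _ e20.
exists (maxn N1 N2) => Q Qoo.
apply: (@le_trans _ _ (\int[Q]_w (excess X1 N1 w + excess X2 N2 w))).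
  apply: ae_le_integral; first exact: measurable_excess.
    by apply: emeasurable_funD; exact: measurable_excess.
  apply: filterS (ac_ae Q XX) => w Xw.
  apply: (@le_trans _ _ (maxe (excess X1 N1 w) (excess X2 N2 w))).
    move: Xw; rewrite le_max => /orP[] Xw.
      rewrite le_max; apply/orP; left.
      apply: le_trans (le_excess _ _ (leq_maxl N1 N2)).
      by rewrite !excessE ge_max !le_max lexx orbT andbT leeB.
    rewrite le_max; apply/orP; right.
    apply: le_trans (le_excess _ _ (leq_maxr N1 N2)).
    by rewrite !excessE ge_max !le_max lexx orbT andbT leeB.
  rewrite ge_max leeDl ?excess_ge0//= leeDr ?excess_ge0//.
rewrite ge0_integralD//; try exact: measurable_excess;
  try (by move=> w _; exact: excess_ge0).
apply: le_trans (leeD (X1N Q Qoo) (X2N Q Qoo)) _.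
rewrite -(fineK (penalty_fin_num Qoo)) -EFinD -!EFinM lee_fin.
lra.
Qed.

Lemma tail_controlled_cst (m : R) : tail_controlled (cst m%:E).
Proof.
move=> e e0; exists (Num.bound `|m|%R) => Q Qoo.
rewrite integral0_eq; last first.
  move=> w _; rewrite excessE; apply/max_idPr.
  rewrite /= -EFinB lee_fin subr_le0.
  exact: le_trans (ler_norm _) (ltW (archi_boundP (normr_ge0 m))).
by rewrite mule_ge0 ?adde_ge0 ?(penalty_ge0 gammaP)// lee_fin ltW.
Qed.

Lemma integral_funepos_tail X (e : R) : measurable_fun setT X ->
  tail_controlled X -> (0 < e)%R -> exists N : nat, forall Q, dom Q ->
  \int[Q]_w X^\+ w <= e%:E * (1 + gamma Q) + N%:R%:E.
Proof.
move=> mX tX e0; have [N XN] := tX _ e0; exists N => Q Qoo.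
apply: (@le_trans _ _ (\int[Q]_w (excess X N w + N%:R%:E))).
  apply: ge0_le_integral => //.
  - exact: measurable_funepos.
  - by apply: emeasurable_funD => //; exact: measurable_excess.
  - move=> w _;
    rewrite funeposE excessE ge_max adde_ge0 ?le_max ?lexx ?orbT ?andbT//.
    case: (X w) => [r| |] //; rewrite -?EFinB; last by rewrite leNye.
    by rewrite -leeBlDr// le_max -EFinB lexx.
rewrite ge0_integralD//; [|by move=> w _;
  exact: excess_ge0|exact: measurable_excess].
rewrite leeD ?XN//.
by rewrite integral_cst//= probability_setT mule1.
Qed.

(** On [{X > 2 N}] the whole of [X^+] is at most twice its excess over [N];
    conversely the excess over [N] is at most [X^+ 1_{X > N}]. *)
Lemma Mrhou_tail X : measurable_fun setT X ->
  Mrhou gamma X^\+ <-> L0 P X^\+ /\ tail_controlled X.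
Proof.
move=> mX.
pose tr (a : R) (N : nat) := fun w => a%:E * `|X^\+ w| *
  (\1_[set v | (N%:R%:E < `|X^\+ v|)%E] w)%:E.
have mtr (a : R) (N : nat) : measurable_fun setT (tr a N).
  apply: emeasurable_funM.
    apply: emeasurable_funM => //; apply: measurableT_comp => //.
    exact: measurable_funepos.
  apply/measurable_EFinP; apply: measurable_indic.
  have mXp : measurable_fun setT (fun w => `|X^\+ w|).
    by apply: measurableT_comp => //; exact: measurable_funepos.
  rewrite [X in measurable X](_ : _ = setT `&` [set v | N%:R%:E < `|X^\+ v|])
    ?setTI//.
  by rewrite -[X in measurable X]setTI; apply: measurable_lte.
have absp w : `|X^\+ w| = X^\+ w by rewrite gee0_abs.
split=> [[L0X lim]|[L0X tX]]; split => //.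
  move=> e e0.
  have e'0 : (0 < e^-1)%R by rewrite invr_gt0.
  have /fine_cvgP[finN /cvgrPdist_lt/(_ _ ltr01) limN] := lim _ e'0.
  have [N [Nfin Nlt]] : exists N : nat, rho gamma (tr e^-1%R N) \is a fin_num /\
      rho gamma (tr e^-1%R N) <= 1.
    have [N _ /(_ N (leqnn N)) /= [h1]] := filterI finN limN.
    rewrite sub0r normrN => h2; exists N; split => //.
    by rewrite -(fineK h1) lee_fin ltW// (le_lt_trans (ler_norm _) h2).
  exists N => Q Qoo.
  have := le_trans (integral_le_rho _ Qoo) (leeD2r (gamma Q) Nlt).
  pose Z := tr e^-1%R N; rewrite -/Z => ZQ.
  apply: (@le_trans _ _ (\int[Q]_w (e%:E * Z w))).
    apply: ge0_le_integral => //.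
    - by move=> w _; exact: excess_ge0.
    - exact: measurable_excess.
    - by apply: emeasurable_funM => //; exact: mtr.
    - move=> w _;
      rewrite /Z /tr !muleA -EFinM divff ?gt_eqF// mul1e absp excessE.
      rewrite indicE; have [h|h] := boolP (w \in _).
        rewrite mule1 ge_max funepos_ge0 andbT funeposE le_max.
        by rewrite leeBlDr// leeDl// lee_fin.
      rewrite mule0 ge_max lexx andbT leeBlDr// add0e leNgt.
      apply: contra h => h; apply: mem_set; rewrite /= absp.
      by apply: lt_le_trans h _; rewrite funeposE le_max lexx.
  rewrite ge0_integralZl_EFin ?(ltW e0)//; last 2 first.
    - by move=> w _; rewrite /Z /tr !mule_ge0// ?lee_fin ?invr_ge0 ?ltW.
    - exact: mtr.
  by rewrite lee_wpmul2l// lee_fin ltW.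
move=> a a0.
have Z0 (N : nat) w : 0 <= tr a N w.
  by rewrite /tr !mule_ge0// lee_fin ?ltW.
have small (e : R) : (0 < e)%R -> exists N0 : nat, forall N : nat, (N0 <= N)%N
  ->
    rho gamma (tr a N) <= e%:E.
  (* [m <= 1] leaves at most one [gamma Q], which is subtracted in [rho] *)
  move=> e0; pose m := Num.min e 1%R.
  have m0 : (0 < m)%R by rewrite lt_min e0 ltr01.
  have [|N0 XN0] := tX (m / (2 * a))%R; first by rewrite divr_gt0// mulr_gt0.
  exists (2 * N0)%N => N NN; apply: ge_ereal_sup => _ [Q Qoo <-].
  rewrite leeBlDr ?penalty_fin_num//.
  apply: (@le_trans _ _ (\int[Q]_w ((2 * a)%:E * excess X N0 w))).
    apply: ge0_le_integral => //.
    - by apply: emeasurable_funM => //; exact: measurable_excess.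
    - move=> w _; rewrite /tr absp indicE; have [h|h] := boolP (w \in _);
      last first.
        by rewrite mule0 mule_ge0 ?excess_ge0// lee_fin mulr_ge0// ltW.
      rewrite mule1 (mulrC 2%R) EFinM -muleA lee_wpmul2l ?lee_fin ?(ltW a0)//.
      move/set_mem : h => /=; rewrite absp excessE funeposE.
      case: (X w) => [r| |]//=.
      + rewrite -EFinB -!EFin_max -EFinM !lte_fin lee_fin => h.
        have rN : (N%:R < r)%R.
          by move: h; rewrite lt_max => /orP[//|]; rewrite ltrn0.
        have {h}NN' : ((2 * N0)%:R <= N%:R :> R)%R by rewrite ler_nat.
        rewrite natrM in NN'.
        have N00 : (0 <= N0%:R :> R)%R by [].
        rewrite ge_max; apply/andP; split; last first.
          by rewrite mulr_ge0// le_max lexx orbT.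
        apply: (@le_trans _ _ (2 * (r - N0%:R))%R); first by lra.
        by rewrite ler_pM2l// le_max lexx.
      + by move=> _; rewrite !maxye ?gt0_muley// lte_fin.
      + by rewrite maxNye lte_fin ltrn0.
  rewrite ge0_integralZl_EFin//; last 3 first.
    - by move=> w _; exact: excess_ge0.
    - exact: measurable_excess.
    - by rewrite mulr_ge0// ltW.
  apply: (@le_trans _ _ ((2 * a)%:E * ((m / (2 * a))%:E * (1 + gamma Q)))).
    by rewrite lee_wpmul2l ?XN0// lee_fin mulr_ge0// ltW.
  rewrite muleA -EFinM mulrC divfK ?gt_eqF ?mulr_gt0//.
  rewrite -(fineK (penalty_fin_num Qoo)) -EFinD -?EFinM -?EFinD lee_fin.
  have := fine_penalty_ge0 Q.
  have : (m <= e)%R by rewrite ge_min lexx.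
  have : (m <= 1)%R by rewrite ge_min lexx orbT.
  by nra.
have tr0 N : 0 <= rho gamma (tr a N) by apply: rho_ge0 => w; exact: Z0.
have trfin N : rho gamma (tr a N) <= 1%:E -> rho gamma (tr a N) \is a fin_num.
  by move=> h; rewrite ge0_fin_numE// (le_lt_trans h)// ltry.
apply/fine_cvgP; split.
  by have [N0 h] := small _ ltr01; exists N0 => // N /= NN; exact/trfin/h.
apply/cvgrPdist_le => e e0.
have [|N0 h] := small (Num.min e 1%R); first by rewrite lt_min e0 ltr01.
exists N0 => // N /= /h; rewrite EFin_min le_min => /andP[he h1].
rewrite sub0r normrN ger0_norm; last exact/fine_ge0/tr0.
by rewrite -lee_fin fineK//; exact: trfin.
Qed.

End penalty_theory.

(** * Integrability of the integrand *)

Section integrand_theory.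
Context d (T : measurableType d) (R : realType) (P : probability T R).
Variable gamma : acprobability P -> \bar R.
Hypothesis gammaP : is_penalty gamma.
Variable f : T -> R -> \bar R.
Hypothesis fP : normal_convex_integrand P f.
Implicit Types (Q : acprobability P) (xi zeta : Linfty P).
Local Notation dom := (dom_penalty gamma).

Lemma measurable_integrand (x : T -> R) : measurable_fun setT x ->
  measurable_fun setT (fun w => f w (x w)).
Proof.
move=> mx;
  apply: (measurableT_comp (integrand_measurable fP) (g := fun w => (w, x w))).
exact: measurable_fun_pair.
Qed.

Lemma fenchel_young w x y : (x * y)%:E - f w x <= conjugate f w y.
Proof. by apply: ereal_sup_ubound; exists x. Qed.

Lemma DrobustP xi : Drobust gamma f xi <->
  L0 P (fun w => f w (xi w))^\+ /\ tail_controlled gamma (fun w => f w (xi w)).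
Proof. by apply: Mrhou_tail => //; exact: measurable_integrand. Qed.

(** Finite convex combinations, pastings and truncations of elements of
    [Drobust] all satisfy this pointwise bound. *)
Lemma Drobust_le_max xi (X1 X2 : T -> \bar R) :
  measurable_fun setT X1 -> measurable_fun setT X2 ->
  {ae P, forall w, X1 w < +oo} -> {ae P, forall w, X2 w < +oo} ->
  {ae P, forall w, f w (xi w) <= maxe (X1 w) (X2 w)} ->
  tail_controlled gamma X1 -> tail_controlled gamma X2 -> Drobust gamma f xi.
Proof.
move=> mX1 mX2 X1oo X2oo fX t1 t2;
  have mf := measurable_integrand (measurable_funP xi).
apply/DrobustP; split; last first.
  exact: (tail_controlled_le_max gammaP mf mX1 mX2 fX t1 t2).
split; first exact: measurable_funepos.
apply: filterS3 X1oo X2oo fX => w h1 h2 h; rewrite funeposE.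
rewrite ge0_fin_numE ?le_max ?lexx ?orbT// gt_max ltry andbT.
by apply: le_lt_trans h _; rewrite gt_max h1.
Qed.

Lemma Drobust_lty xi : Drobust gamma f xi -> {ae P, forall w, f w (xi w) < +oo}.
Proof.
move=> /DrobustP[[_ +] _]; apply: filterS => w; rewrite funeposE => h.
rewrite (@le_lt_trans _ _ (maxe (f w (xi w)) 0)) ?le_max ?lexx//.
by rewrite -ge0_fin_numE// le_max lexx orbT.
Qed.

Lemma Drobust_between (xi zeta chi : Linfty P) :
  Drobust gamma f xi -> Drobust gamma f zeta ->
  {ae P, forall w, f w (chi w) <= maxe (f w (xi w)) (f w (zeta w))} ->
  Drobust gamma f chi.
Proof.
move=> xiD zetaD chi_le.
have /DrobustP[_ txi] := xiD; have /DrobustP[_ tzeta] := zetaD.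
apply: (Drobust_le_max _ _ _ _ chi_le txi tzeta).
- exact: measurable_integrand.
- exact: measurable_integrand.
- exact: Drobust_lty.
- exact: Drobust_lty.
Qed.

Lemma Drobust_paste (A : set T) xi zeta : measurable A ->
  Drobust gamma f xi -> Drobust gamma f zeta
    -> Drobust gamma f (paste A xi zeta).
Proof.
move=> mA xiD zetaD; apply: (Drobust_between xiD zetaD).
apply: nearW => w; rewrite pasteE//.
by case: ifP => _; rewrite le_max lexx ?orbT.
Qed.

Lemma Drobust_convex xi zeta (t : R) : (0 <= t <= 1)%R ->
  Drobust gamma f xi -> Drobust gamma f zeta ->
  Drobust gamma f (t *: xi + (1 - t) *: zeta)%R.
Proof.
move=> /andP[t0 t1] xiD zetaD; apply: (Drobust_between xiD zetaD).
apply: filterS (integrand_convex fP) => w cf; rewrite LinftyDE !LinftyZE.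
apply: le_trans (cf _ _ t _) _; first by rewrite t0.
have t1' : (0 <= 1 - t)%R by rewrite subr_ge0.
set m := maxe _ _.
have hx : t%:E * f w (xi w) <= t%:E * m.
  by rewrite lee_wpmul2l ?lee_fin// le_max lexx.
have hy : (1 - t)%:E * f w (zeta w) <= (1 - t)%:E * m.
  by rewrite lee_wpmul2l ?lee_fin// le_max lexx orbT.
apply: le_trans (leeD hx hy) _.
rewrite -ge0_muleDl ?lee_fin// -EFinD addrC subrK mul1e.
exact: lexx.
Qed.

(** With error [1 + gamma(Q)] in the tail estimate, the penalty cancels and
    [E_Q[f(xi)] - gamma(Q) <= 1 + N]. *)
Lemma Drobust_dom : Drobust gamma f `<=` dom_robust gamma f.
Proof.
move=> xi /DrobustP[_ tf].
have mf := measurable_integrand (measurable_funP xi).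
have [N fN] := integral_funepos_tail mf tf ltr01.
apply: (@le_lt_trans _ _ (1 + N%:R)%:E); last exact: ltry.
apply: ge_ereal_sup => _ [Q Qoo <-].
rewrite leeBlDr ?(penalty_fin_num gammaP)//.
apply: le_trans (_ : _ <= \int[Q]_w (fun v => f v (xi v))^\+ w) _.
  apply: ae_le_integral => //; first exact: measurable_funepos.
  by apply: nearW => w; rewrite funeposE le_max lexx.
apply: (le_trans (fN Q Qoo)).
by rewrite mul1e EFinD addeAC.
Qed.

Variable eta0 : T -> R.
Hypothesis eta0P : Lrho gamma (EFin \o eta0).
Hypothesis conj_eta0P : Lrho gamma (fun w => conjugate f w (eta0 w))^\+.

(** Young's inequality at [eta0] bounds [f(xi)] from below by [xi eta0 -
    f^*(eta0)^+]. *)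
Lemma integrable_funeneg_integrand Q xi : dom Q ->
  Q.-integrable setT (fun w => f w (xi w))^\-.
Proof.
move=> Qoo; have [M M0 xiM] := Linfty_bounded xi.
have i1 := Lrho_integrable gammaP Qoo eta0P.
have i2 := Lrho_integrable gammaP Qoo conj_eta0P.
apply: (@ae_le_integrable _ _ _ _ _ (fun w => M%:E * `|(eta0 w)%:E| +
  (fun w => conjugate f w (eta0 w))^\+ w)).
- exact/measurable_funeneg/measurable_integrand.
- apply: integrableD => //; apply: integrableZl => //.
  exact: integrable_abse.
- apply: filterS (ac_ae Q xiM) => w h; rewrite gee0_abs ?funeneg_ge0//.
  rewrite funenegE funeposE.
  set c := maxe (conjugate _ _ _) _.
  have c0 : 0 <= c by rewrite le_max lexx orbT.
  have hc : (xi w * eta0 w)%:E - f w (xi w) <= c.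
    by rewrite le_max fenchel_young.
  have Meta : (`|xi w * eta0 w| <= M * `|eta0 w|)%R.
    by rewrite normrM ler_wpM2r.
  have Meta0 : (0 <= M * `|eta0 w|)%R by rewrite mulr_ge0.
  rewrite ge_max; apply/andP; split; last by rewrite adde_ge0// -EFinM lee_fin.
  case E : (f w (xi w)) hc => [r| |].
  + rewrite -EFinB => hc.
    have -> : - r%:E = (- (xi w * eta0 w))%:E + (xi w * eta0 w - r)%:E.
      by rewrite -EFinD addKr.
    apply: leeD; last exact: hc.
    rewrite -EFinM lee_fin; apply: le_trans Meta.
    by rewrite -normrN; exact: ler_norm.
  + by move=> _; exact: leNye.
  + by have := integrand_gtNy fP w (xi w); rewrite E.
Qed.

Lemma dom_robust_integrable Q xi : dom Q -> dom_robust gamma f xi ->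
  Q.-integrable setT (fun w => f w (xi w)).
Proof.
move=> Qoo xi_dom; set X := fun w => f w (xi w).
have mX : measurable_fun setT X := measurable_integrand (measurable_funP xi).
have iN := integrable_funeneg_integrand xi Qoo.
have : \int[Q]_w X w < +oo.
  apply: le_lt_trans (integral_le_rho gammaP X Qoo) _.
  by rewrite lte_add_pinfty.
rewrite integralE.
have Nfin : \int[Q]_w X^\- w \is a fin_num by exact: integrable_fin_num.
rewrite -(fineK Nfin) => h; apply/integrableP; split => //.
rewrite -[fun w => _]/(abse \o X) fune_abse ge0_integralD//; last 2 first.
  exact: measurable_funepos.
  exact: measurable_funeneg.
rewrite -(fineK Nfin).
have : 0 <= \int[Q]_w X^\+ w by exact: integral_ge0.
move: h; case: (\int[Q]_w X^\+ w) => [r _ _| |//].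
  by rewrite -EFinD; exact: ltry.
by rewrite addye// ltxx.
Qed.

(** Finiteness holds almost surely under a measure equivalent to [P]. *)
Lemma dom_robust_fin_num xi : dom_robust gamma f xi ->
  {ae P, forall w, f w (xi w) \is a fin_num}.
Proof.
move=> xi_dom; have [Q0 [PQ0 Q0oo]] := penalty_equiv gammaP.
have /integrable_ae := dom_robust_integrable Q0oo xi_dom.
move=> /(_ measurableT)[N [mN N0 subN]]; exists N; split => //.
  by have /null_content_dominatesP := PQ0; apply.
by move=> w nw; apply: subN => /= h; apply: nw; exact: h.
Qed.

End integrand_theory.

(** * Weak compactness and semicontinuity *)

Section weak_topology.
Context d (T : measurableType d) (R : realType) (P : probability T R).
Implicit Types Q : acprobability P.

(** The converse of the continuity of the pairings: both the initial and the
    product topology are generated by preimages, here of open sets of reals. *)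
Lemma weak_cvg (F : set_system (weak_acprobability P)) (Q : weak_acprobability
  P) :
  Filter F -> (forall xi : Linfty P,
    (fun Q' : acprobability P => pairing Q' xi) @ F --> (pairing Q xi : R)) ->
  F --> Q.
Proof.
move=> FF cvgF U [?/= [[W oW <-]]] /= WQ /filterS; apply.
have : (@pairing _ _ _ P) @ F --> (pairing Q : prod_topology (fun _ : Linfty P
  => R)).
  apply/cvg_sup => xi V [?/= [[W' oW' <-]]] /= W'Q /filterS; apply.
  by apply: (cvgF xi); exact: open_nbhs_nbhs.
by apply; exact: open_nbhs_nbhs.
Qed.

Lemma pairing_continuous (xi : Linfty P) (Q : weak_acprobability P) :
  (fun Q' : weak_acprobability P => pairing (Q' : acprobability P) xi)
    @ nbhs Q --> (pairing (Q : acprobability P) xi : R).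
Proof.
have h1 := @initial_continuous _ _ (@pairing _ _ _ P) Q.
have h2 := @proj_continuous (Linfty P) (fun=> R) xi (pairing (Q : acprobability
  P)).
exact: (cvg_comp _ _ h1 h2).
Qed.

Lemma ultra_fmap (X Y : Type) (m : X -> Y) (U : set_system X) :
  UltraFilter U -> UltraFilter (m @ U).
Proof.
move=> UU; split; first exact: fmap_proper_filter.
move=> G GG UG; apply/seteqP; split => [A GA|//].
have [//|UnA] := in_ultra_setVsetC (m @^-1` A) UU.
have GnA : G (A `&` ~` A) by apply: filterI => //; exact: UG.
by have [x []] := filter_ex GnA.
Qed.

End weak_topology.

Section penalty_topology.
Context d (T : measurableType d) (R : realType) (P : probability T R).
Variable gamma : acprobability P -> \bar R.
Hypothesis gammaP : is_penalty gamma.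
Implicit Types Q : acprobability P.
Local Notation dom := (dom_penalty gamma).

Lemma pairing_mixture (Q Q0 Q1 : acprobability P) (t : R) (xi : Linfty P) :
  (0 <= t <= 1)%R -> mixture Q Q0 Q1 t ->
  pairing Q xi = (t * pairing Q0 xi + (1 - t) * pairing Q1 xi)%R.
Proof.
move=> t01 Qt; apply: EFin_inj; rewrite EFinD !EFinM !pairingE.
by rewrite (integral_mixture t01 Qt)//; exact: integrable_Linfty.
Qed.

Lemma pairing_indic Q A : measurable A
  -> (pairing Q (toLinfty P \1_A))%:E = Q A.
Proof.
move=> mA; rewrite pairingE indic_LinftyE// integral_indic// setIT.
by [].
Qed.

Lemma penalty_sublevel_closed (U : set_system (weak_acprobability P)) Q (c : R)
  :
  ProperFilter U -> U [set Q' | gamma Q' <= c%:E] ->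
  U --> (Q : weak_acprobability P) -> gamma Q <= c%:E.
Proof.
move=> UU Uc UQ; rewrite leNgt; apply/negP => cQ.
have [V QV Vc] := (penalty_lsc gammaP : lower_semicontinuous _) Q c cQ.
have UV : U ([set Q' | gamma Q' <= c%:E] `&` V) by apply: filterI => //;
  exact: UQ.
have [Q' [/= h1 /Vc h2]] := filter_ex UV.
by move: h2; rewrite ltNge h1.
Qed.

(** Mixing [Q] with a fixed cheap measure [Q1], in a proportion [t] small
    enough, maps the sublevel set at [c] into the one at [1]; the weight of
    [Q1] is a lower bound that survives in limits, so that mixing can be
    undone. *)
Lemma compact_sublevel (c : R) :
  compact ([set Q | gamma Q <= c%:E] : set (weak_acprobability P)).
Proof.
have half0 : (0 < 2^-1 :> R)%R by rewrite invr_gt0.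
have [Q1 Q1oo Q1e] := small_penalty gammaP half0.
(* small enough for [t * c] to be at most 1/2, the bound on [gamma Q1] *)
pose t := (2 * (1 + `|c|))^-1%R.
have c1 : (1 <= 1 + `|c|)%R by rewrite lerDl.
have t0 : (0 < t)%R by rewrite invr_gt0 mulr_gt0// (lt_le_trans ltr01).
have tc : (t * (2 * (1 + `|c|)) = 1)%R.
  by rewrite mulVf// gt_eqF// mulr_gt0// (lt_le_trans ltr01).
have c0 : (c <= `|c|)%R by rewrite ler_norm.
have c00 : (0 <= `|c|)%R by [].
have t1 : (t <= 2^-1)%R by nra.
have t01 : (0 <= t <= 1)%R by rewrite (ltW t0)/=; lra.
have mixQ Q : {Q' | mixture Q' Q Q1 t} by apply: cid; exact: mixture_exists.
pose m Q := sval (mixQ Q).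
have mE Q : mixture (m Q) Q Q1 t by exact: (svalP (mixQ Q)).
rewrite compact_ultra => U UU Uc.
have UmU : UltraFilter (m @ U) by exact: ultra_fmap.
have Um1 : (m @ U) [set Q | gamma Q <= 1].
  change (U (m @^-1` [set Q | gamma Q <= 1])).
  apply: (filterS _ Uc) => Q /= Qc.
  apply: le_trans (@penalty_convex _ _ _ _ _ gammaP _ _ _ _ t01 (mE Q)) _.
  have Q0 := penalty_ge0 gammaP Q; have Q10 := penalty_ge0 gammaP Q1.
  move: Qc Q1e Q0 Q10; case: (gamma Q) => [q| |]//;
    case: (gamma Q1) => [q1| |]//.
  rewrite !lee_fin lte_fin => qc q1e q0 q10.
  by nra.
have := penalty_compact gammaP;
  rewrite compact_ultra => /(_ _ UmU Um1)[Q' [_ UQ']].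
have cvgm (xi : Linfty P) :
    (fun Q => t * pairing Q xi + (1 - t) * pairing Q1 xi)%R @ U --> pairing Q'
      xi.
  have : (fun Q => pairing (m Q) xi) @ U --> pairing Q' xi.
    exact: (cvg_comp _ _ UQ' (@pairing_continuous _ _ _ P xi Q')).
  by under eq_fun do rewrite (pairing_mixture xi t01 (mE _)).
have cvgU (xi : Linfty P) : (fun Q => pairing Q xi) @ U -->
    (t^-1 * (pairing Q' xi - (1 - t) * pairing Q1 xi))%R.
  rewrite (_ : (fun Q => pairing Q xi) = (fun Q => t^-1 *
      (t * pairing Q xi + (1 - t) * pairing Q1 xi - (1 - t) * pairing Q1
        xi))%R).
    by apply: cvgM; [exact: cvg_cst|apply: cvgB; [exact: cvgm|exact: cvg_cst]].
  by apply/funext => Q; rewrite addrK mulKf// gt_eqF.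
have [A mA|Q Qm] := @affine_acprobability _ _ _ P Q' Q1 t^-1%R.
  rewrite -!pairing_indic// -!EFinM -EFinD lee_fin.
  have -> : (t^-1 * pairing Q' (toLinfty P \1_A) +
      (1 - t^-1) * pairing Q1 (toLinfty P \1_A) =
      t^-1 * (pairing Q' (toLinfty P \1_A) - (1 - t) * pairing Q1 (toLinfty P
        \1_A)))%R.
    by field; rewrite gt_eqF.
  apply: (cvgr_to_ge (cvgU _)); apply: nearW => Q.
  by rewrite -lee_fin pairing_indic.
have Q'm : mixture Q' Q Q1 t.
  move=> A mA; rewrite Qm// -!pairing_indic//.
  rewrite -!EFinM -EFinD; congr EFin.
  by field; rewrite gt_eqF.
have UQ : U --> (Q : weak_acprobability P).
  apply: weak_cvg => xi.
  suff -> : pairing Q xi = (t^-1 * (pairing Q' xi - (1 - t) * pairing Q1 xi))%R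
    by exact: cvgU.
  by rewrite (pairing_mixture xi t01 Q'm) addrK mulKf// gt_eqF.
by exists Q; split => //=; exact: penalty_sublevel_closed Uc UQ.
Qed.

Lemma excess_le_abs (X : T -> \bar R) N w : excess X N w <= `|X w|.
Proof.
rewrite excessE ge_max abse_ge0 andbT leeBlDr//.
by rewrite (le_trans (lee_abs _))// leeDl ?lee_fin.
Qed.

Lemma integrable_excess Q (X : T -> \bar R) N :
  Q.-integrable setT X -> Q.-integrable setT (excess X N).
Proof.
move=> iX; apply: (@ae_le_integrable _ _ _ _ _ (fun w => `|X w|)).
- exact/measurable_excess/(measurable_int _ iX).
- exact: integrable_abse.
- by apply: nearW => w; rewrite gee0_abs ?excess_ge0// excess_le_abs.
Qed.

Lemma excess_vanishes Q (X : T -> \bar R) (e : R) : Q.-integrable setT X ->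
  (0 < e)%R -> exists N0 : nat, forall N, (N0 <= N)%N ->
    \int[Q]_w excess X N w <= e%:E.
Proof.
move=> iX e0; have mX := measurable_int _ iX.
have lim0 : {ae Q, forall w, setT w
  -> excess X n w @[n --> \oo] --> (cst 0 w : \bar R)}.
  have := integrable_ae measurableT iX; apply: filterS => w /(_ I) Xw _.
  have [N0 XN0] : exists N0 : nat, X w <= N0%:R%:E.
    exists (Num.bound `|fine (X w)|%R); rewrite -(fineK Xw) lee_fin.
    by rewrite (le_trans (ler_norm _))// ltW// archi_boundP.
  apply: cvg_near_cst; exists N0 => // N /= NN0; apply/eqP; rewrite excessE.
  apply/eqP/max_idPr; rewrite -(fineK Xw) -EFinB lee_fin subr_le0.
  by rewrite -lee_fin fineK// (le_trans XN0)// lee_fin ler_nat.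
have dom0 : {ae Q, forall w n, setT w -> `|excess X n w| <= X^\+ w}.
  apply: nearW => w n _; rewrite gee0_abs ?excess_ge0//.
  rewrite excessE funeposE ge_max !le_max lexx orbT andbT leeBlDr//.
  by rewrite leeDl ?lee_fin.
have mexc n : measurable_fun setT (excess X n) by exact: measurable_excess.
have [_ _] := dominated_convergence measurableT mexc (measurable_cst 0)
  lim0 (integrable_funepos measurableT iX) dom0.
rewrite integral0.
move=> /fine_cvgP[[N1 _ fin1]] /cvgrPdist_le/(_ e e0)[N2 _ le2].
exists (maxn N1 N2) => N; rewrite geq_max => /andP[/fin1 /= h1 /le2 /=].
rewrite sub0r normrN => h2; rewrite -(fineK h1) lee_fin.
exact: le_trans (ler_norm _) h2.
Qed.

(** Up to an error that is uniform on a sublevel set, the integral of [X] is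
    that of a bounded truncation, which is weakly continuous. *)
Lemma integral_usc (X : T -> \bar R) (c a : R) Q :
  tail_controlled gamma X -> measurable_fun setT X ->
  (forall Q', dom Q' -> Q'.-integrable setT X) ->
  gamma Q <= c%:E -> \int[Q]_w X w < a%:E ->
  nbhs (Q : weak_acprobability P)
    [set Q' | gamma Q' <= c%:E -> \int[Q']_w X w < a%:E].
Proof.
move=> tX mX iX Qc Xa.
have cdom Q' : gamma Q' <= c%:E -> dom Q' by move=> /le_lt_trans; apply;
  exact: ltry.
have Xfin Q' : gamma Q' <= c%:E -> \int[Q']_w X w \is a fin_num.
  by move=> Q'c; apply: integrable_fin_num => //; exact/iX/cdom.
(* three errors of size [e]: the two truncations and the weak neighborhood *)
pose e := ((a - fine (\int[Q]_w X w)) / 4)%R.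
have e0 : (0 < e)%R by rewrite divr_gt0// subr_gt0 -lte_fin fineK// Xfin.
have c0 : (0 <= c)%R by rewrite -lee_fin (le_trans (penalty_ge0 gammaP Q)).
(* [1 + c] bounds the factor [1 + gamma] of the tail estimate *)
have e'0 : (0 < e / (1 + c))%R by rewrite divr_gt0// ltr_wpDr.
have [N1 XN1] := tX _ e'0.
have [N2 XN2] := excess_vanishes (integrableN (iX _ (cdom _ Qc))) e0.
pose N := maxn N1 N2.
pose y w := fine (maxe (mine (X w) N%:R%:E) (- N%:R)%:E).
have yE w : (y w)%:E = maxe (mine (X w) N%:R%:E) (- N%:R)%:E.
  rewrite /y fineK//; case: (X w) => [r| |].
  - by rewrite -EFin_min -EFin_max.
  - by rewrite minye -EFin_max.
  - by rewrite minNye maxNye.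
have yN w : (`|y w| <= N%:R)%R.
  rewrite ler_norml -!lee_fin yE le_max lexx orbT/= ge_max ge_min lexx orbT/=.
  by rewrite lee_fin (@le_trans _ _ 0%R)// oppr_le0.
have my : measurable_fun setT y.
  apply/measurable_EFinP.
  rewrite (_ : _ \o _ = (fun w => maxe (mine (X w) N%:R%:E) (- N%:R)%:E));
    last first.
    by apply/funext => w; rewrite /= yE.
  by apply: measurable_maxe => //; exact: measurable_mine.
have yLE : toLinfty P y = y :> (T -> R)
  by apply: (@toLinftyE _ _ _ _ _ N%:R%R my); exact: nearW.
have iy Q' : Q'.-integrable setT (EFin \o y).
  by have := integrable_Linfty Q' (toLinfty P y); rewrite yLE.
have yQ Q' : (pairing Q' (toLinfty P y))%:E = \int[Q']_w (y w)%:E.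
  by rewrite pairingE yLE.
have Xy w : X w <= (y w)%:E + excess X N w.
  rewrite yE excessE; case: (X w) => [r| |].
  - rewrite -EFin_min -EFinB -!EFin_max -EFinD lee_fin.
    case: (ltP r N%:R%R) => rN.
      by rewrite (le_trans _ (lerD (lexx _) (_ : 0 <= _)%R)) ?addr0 ?le_max
        ?lexx ?orbT.
    apply: (@le_trans _ _ (N%:R + (r - N%:R))%R);
      first by rewrite addrCA subrr addr0.
    by rewrite lerD// le_max lexx.
  - by rewrite minye -EFin_max maxye addey.
  - by rewrite leNye.
have yX w : X w \is a fin_num -> (y w)%:E <= X w + excess (-%E \o X) N w.
  rewrite yE excessE /=; case: (X w) => [r _|//|//].
  rewrite -EFin_min -EFinN -EFinB -!EFin_max -EFinD lee_fin ge_max.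
  apply/andP; split.
    rewrite (@le_trans _ _ r)//; first by rewrite ge_min lexx.
    by rewrite lerDl le_max lexx orbT.
  apply: (@le_trans _ _ (r + (- r - N%:R))%R);
    first by rewrite addrA subrr add0r.
  by rewrite lerD// le_max lexx.
have upper Q' : gamma Q' <= c%:E ->
    \int[Q']_w X w <= (pairing Q' (toLinfty P y) + e)%:E.
  move=> Q'c; apply: (@le_trans _ _ (\int[Q']_w ((y w)%:E + excess X N w))).
    apply: ae_le_integral => //; last exact: nearW.
    by apply: emeasurable_funD;
      [exact/measurable_EFinP|exact: measurable_excess].
  rewrite integralD//; [|exact: iy|by apply: integrable_excess; exact/iX/cdom].
  rewrite EFinD yQ leeD2l//.
  apply: (@le_trans _ _ (\int[Q']_w excess X N1 w)).
    apply: ae_le_integral; [exact: measurable_excess..|].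
    by apply: nearW => w; apply: le_excess; exact: leq_maxl.
  apply: (le_trans (XN1 Q' (cdom _ Q'c))).
  apply: (@le_trans _ _ ((e / (1 + c))%:E * (1 + c%:E))).
    by rewrite lee_wpmul2l ?leeD2l// lee_fin ltW.
  by rewrite -EFinD -EFinM lee_fin divfK// gt_eqF// ltr_wpDr.
have lower : (pairing Q (toLinfty P y))%:E <= \int[Q]_w X w + e%:E.
  have iXQ := iX _ (cdom _ Qc).
  have iNX : Q.-integrable setT (-%E \o X) by exact: integrableN.
  rewrite yQ; apply: (@le_trans _ _ (\int[Q]_w (X w + excess (-%E \o X) N w))).
    apply: ae_le_integral; first exact/measurable_EFinP.
      by apply: emeasurable_funD => //; apply: measurable_excess;
        exact: measurable_int iNX.
    have := integrable_ae measurableT iXQ; apply: filterS => w /(_ I).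
    exact: yX.
  rewrite integralD//; last exact: integrable_excess.
  by rewrite leeD2l// XN2// leq_maxr.
have /cvgrPdist_lt/(_ e e0) := @pairing_continuous _ _ _ P (toLinfty P y) Q.
apply: filterS => Q' /= dist Q'c.
apply: (le_lt_trans (upper _ Q'c)); rewrite lte_fin.
move: lower; rewrite -(fineK (Xfin _ Qc)) -EFinD lee_fin => lower.
have aE : (a = fine (\int[Q]_w X w) + 4 * e)%R.
  by rewrite /e mulrCA divff// mulr1 addrC subrK.
move: dist; rewrite ltr_norml => /andP[d1 _].
clearbody e; lra.
Qed.

End penalty_topology.

(** * The inner supremum for a fixed probability *)

(** A supremum over the domain of a convex function of one variable is already
    approached along the rationals, once one further point [a] of the domain is
    taken into account: either the domain is [{a}], or every other point [x] of
    it is a limit of rationals of the segment between [x] and [a]. *)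
Lemma convex_sup_rat (R : realType) (g : R -> \bar R) (a y z : R) (G : \bar R) :
  convex_efun g -> (forall x, -oo < g x) -> (0 <= z)%R -> g a < +oo ->
  (a * y)%:E - z%:E * g a <= G ->
  (forall q : rat, g (ratr q) < +oo ->
    (ratr q * y)%:E - z%:E * g (ratr q) <= G) ->
  forall x, g x < +oo -> (x * y)%:E - z%:E * g x <= G.
Proof.
move=> gconv gNy z0 ga aG qG x gx.
have gfin v : g v < +oo -> exists r, g v = r%:E.
  by move=> gv; exists (fine (g v)); rewrite fineK// fin_numElt gNy gv.
have [ra gaE] := gfin a ga; have [rx gxE] := gfin x gx.
move: aG; rewrite gaE gxE -!EFinM -!EFinB => aG.
set b0 := (a * y - z * ra)%R in aG *; set b := (x * y - z * rx)%R.
rewrite leNgt; apply/negP => Gb.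
have [l GE] : exists l, G = l%:E.
  by move: aG Gb; case: G {qG} => [l| |]//; exists l.
move: aG Gb; rewrite GE lee_fin lte_fin => b0l lb.
have xa : (0 < b - b0)%R by lra.
(* a step from [x] towards [a] of less than [del] keeps the value above [l] *)
pose del := ((b - l) / (b - b0))%R.
have del0 : (0 < del)%R by rewrite divr_gt0//; lra.
have delE : (del * (b - b0) = b - l)%R by rewrite divfK// gt_eqF.
have del1 : (del <= 1)%R by rewrite ler_pdivrMr// mul1r; lra.
have ax : (a - x != 0)%R.
  apply: contraTneq xa => /eqP; rewrite subr_eq0 => /eqP ax.
  move: gxE; rewrite -ax gaE => -[rarx].
  by rewrite /b /b0 -ax rarx subrr ltxx.
have [s /andP[s0 sdel] [q qE]] : exists2 s : R, (0 < s < del)%R &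
    exists q : rat, (x + s * (a - x) = ratr q)%R.
  have [ax0|ax0] : (0 < a - x)%R \/ (a - x < 0)%R.
    by apply/orP; rewrite orbC -neq_lt.
  - have /rat_in_itvoo[q] : (x < x + del * (a - x))%R by rewrite ltrDl mulr_gt0.
    rewrite in_itv/= => /andP[xq qx]; exists ((ratr q - x) / (a - x))%R.
      have qx0 : (0 < ratr q - x)%R by rewrite subr_gt0.
      by rewrite divr_gt0//= ltr_pdivrMr// ltrBlDl.
    by exists q; rewrite divfK// addrC subrK.
  - have /rat_in_itvoo[q] : (x + del * (a - x) < x)%R.
      by rewrite gtrDl pmulr_rlt0.
    rewrite in_itv/= => /andP[xq qx]; exists ((ratr q - x) / (a - x))%R.
      rewrite ltr_ndivlMr// ltr_ndivrMr// mul0r; apply/andP; split; lra.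
    by exists q; rewrite divfK// addrC subrK.
have s01 : (0 <= s <= 1)%R by apply/andP; split; lra.
have := gconv a x s s01.
have -> : (s * a + (1 - s) * x = ratr q)%R by rewrite -qE; ring.
rewrite gaE gxE -!EFinM -EFinD => gq.
have gqoo : g (ratr q) < +oo by apply: le_lt_trans gq (ltry _).
have := qG q gqoo; have [rq gqE] := gfin _ gqoo; move: gq; rewrite gqE GE.
rewrite -EFinM -EFinB !lee_fin => rqle.
have zrq : (z * rq <= z * (s * ra + (1 - s) * rx))%R by rewrite ler_wpM2l.
apply/negP; rewrite -ltNge.
apply: (@lt_le_trans _ _ (s * b0 + (1 - s) * b)%R).
  have : (s * (b - b0) < del * (b - b0))%R by rewrite ltr_pM2r.
  by rewrite delE; lra.
rewrite /b0 /b -qE.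
have -> : (s * (a * y - z * ra) + (1 - s) * (x * y - z * rx) =
   (x + s * (a - x)) * y - z * (s * ra + (1 - s) * rx))%R by ring.
by rewrite lerD2l lerN2.
Qed.

Section fixed_measure.
Context d (T : measurableType d) (R : realType) (P : probability T R).
Hypothesis P_complete : measure_is_complete P.
Variable gamma : acprobability P -> \bar R.
Hypothesis gammaP : is_penalty gamma.
Variable f : T -> R -> \bar R.
Hypothesis fP : normal_convex_integrand P f.
Variable eta0 : T -> R.
Hypothesis eta0P : Lrho gamma (EFin \o eta0).
Hypothesis conj_eta0P : Lrho gamma (fun w => conjugate f w (eta0 w))^\+.
Implicit Types (Q : acprobability P) (xi zeta : Linfty P).
Local Notation dom := (dom_penalty gamma).

Variable eta : T -> R.
Hypothesis ieta : P.-integrable setT (EFin \o eta).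
Variable Q : acprobability P.
Hypothesis Qdom : dom Q.

(** Its [P]-integral is [nur(xi) - E_Q[f(xi)]] when [eta] is the density of
    [nur]. *)
Definition gain xi w : \bar R :=
  (xi w * eta w)%:E - (density Q w)%:E * f w (xi w).

Lemma measurable_gain xi : measurable_fun setT (gain xi).
Proof.
have /measurable_EFinP meta := measurable_int _ ieta.
apply: emeasurable_funB; first exact/measurable_EFinP/measurable_funM.
apply: emeasurable_funM; first exact/measurable_EFinP/measurable_density.
exact: (measurable_integrand fP).
Qed.

Section dom_gain.
Variables (xi : Linfty P) (xi_dom : dom_robust gamma f xi).

Let if_xi : Q.-integrable setT (fun w => f w (xi w)).
Proof. exact: (dom_robust_integrable gammaP fP eta0P conj_eta0P). Qed.

Let idf_xi : P.-integrable setT (fun w => (density Q w)%:E * f w (xi w)).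
Proof.
apply: (@eq_integrable _ _ _ _ _ measurableT
  (fun w => f w (xi w) * (density Q w)%:E)).
  by move=> w _; rewrite muleC.
exact: integrable_mul_density.
Qed.

Lemma integrable_gain : P.-integrable setT (gain xi).
Proof. by apply: integrableB => //; exact: integrable_Linfty_mul. Qed.

Lemma integral_gain : \int[P]_w gain xi w =
  \int[P]_w (xi w * eta w)%:E - \int[Q]_w f w (xi w).
Proof.
rewrite integralB//; last exact: integrable_Linfty_mul.
congr (_ - _); rewrite -integral_density//.
by apply: eq_integral => w _; rewrite muleC.
Qed.

Lemma gain_fin_num : {ae P, forall w, gain xi w \is a fin_num}.
Proof.
have := dom_robust_fin_num gammaP fP eta0P conj_eta0P xi_dom.
by apply: filterS => w h; rewrite /gain fin_numB fin_numM.
Qed.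

Lemma gain_le_conjugate :
  {ae P, forall w, gain xi w <= conjugate_tilde f w (eta w) (density Q w)}.
Proof.
have := dom_robust_fin_num gammaP fP eta0P conj_eta0P xi_dom.
apply: filterS => w; rewrite fin_numElt => /andP[_ foo].
by apply: ereal_sup_ubound; exists (xi w).
Qed.

End dom_gain.

Section selection.
Variables (xi0 : Linfty P) (xi0D : Drobust gamma f xi0).

Definition cst_Linfty (r : R) : Linfty P := toLinfty P (cst r).

Lemma cst_LinftyE r w : cst_Linfty r w = r.
Proof. by rewrite /cst_Linfty (@toLinftyE _ _ _ _ _ `|r|%R)//;
  exact: nearW. Qed.

(** The condition [f <= m] keeps the selection in [Drobust]. *)
Definition improve (q : rat) (m : nat) xi : Linfty P :=
  paste [set w | f w (ratr q) <= m%:R%:E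
    /\ gain xi w < gain (cst_Linfty (ratr q)) w]
    (cst_Linfty (ratr q)) xi.

Definition candidate : nat -> option (rat * nat) := @choice.unpickle _.

Lemma candidate_surj q m : exists n, candidate n = Some (q, m).
Proof. by exists (choice.pickle (q, m)); exact: choice.pickleK. Qed.

(* otherwise simplification unfolds the decoding of pairs *)
Local Opaque candidate.

Fixpoint selection (n : nat) : Linfty P :=
  if n is n'.+1 then
    if candidate n' is Some (q, m) then improve q m (selection n')
    else selection n'
  else xi0.

Lemma measurable_improve q m xi : measurable
  [set w | f w (ratr q) <= m%:R%:E /\ gain xi w < gain (cst_Linfty (ratr q)) w].
Proof.
rewrite (_ : [set w | _] = (setT `&` [set w | f w (ratr q) <= m%:R%:E]) `&`
  (setT `&` [set w | gain xi w < gain (cst_Linfty (ratr q)) w])); last first.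
  by rewrite !setTI.
apply: measurableI.
  by apply: measurable_lee => //; exact: (measurable_integrand fP).
by apply: measurable_lte => //; exact: measurable_gain.
Qed.

Lemma improveE q m xi w : improve q m xi w =
  if `[< f w (ratr q) <= m%:R%:E /\ gain xi w < gain (cst_Linfty (ratr q)) w >]
  then ratr q else xi w.
Proof.
rewrite /improve pasteE; last exact: measurable_improve.
by rewrite cst_LinftyE; congr (if _ then _ else _).
Qed.

Lemma gain_improve_ge q m xi w : gain xi w <= gain (improve q m xi) w.
Proof.
rewrite /(gain (improve _ _ _)) improveE; case: asboolP => // -[_].
by rewrite {2}/gain cst_LinftyE => /ltW.
Qed.

Lemma gain_improve_cst q m xi w : f w (ratr q) <= m%:R%:E ->
  (ratr q * eta w)%:E - (density Q w)%:E * f w (ratr q) <= gain (improve q m xi)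
    w.
Proof.
move=> fq; rewrite /(gain (improve _ _ _)) improveE; case: asboolP => // h.
rewrite leNgt; apply/negP => lt; apply: h; split => //.
by rewrite {2}/gain cst_LinftyE.
Qed.

Lemma Drobust_improve q m xi :
  Drobust gamma f xi -> Drobust gamma f (improve q m xi).
Proof.
move=> xiD; have /(DrobustP gammaP fP)[_ txi] := xiD.
apply: (@Drobust_le_max _ _ _ _ _ gammaP _ fP _ (fun w => f w (xi w)) (cst
  m%:R%:E)).
- exact: (measurable_integrand fP).
- exact: measurable_cst.
- exact: (Drobust_lty gammaP fP).
- by apply: nearW => w; exact: ltry.
- apply: nearW => w; rewrite improveE; case: asboolP => [[fq _]|_].
    by rewrite le_max fq orbT.
  by rewrite le_max lexx.
- exact: txi.
- exact: tail_controlled_cst.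
Qed.

Lemma Drobust_selection n : Drobust gamma f (selection n).
Proof.
elim: n => [|n ih]; first exact: xi0D.
by rewrite /=; case: (candidate n) => [[q m]|];
  [exact: Drobust_improve|exact: ih].
Qed.

Lemma gain_selection_mono w : nondecreasing_seq (fun n => gain (selection n) w).
Proof.
apply/nondecreasing_seqP => n /=; case: (candidate n) => [[q m]|//].
exact: gain_improve_ge.
Qed.

(** The maximum with [0] matters on the null set where [gain xi0] is infinite:
    it makes the increments nonnegative everywhere. *)
Definition gain_increment n w := maxe (gain (selection n) w - gain xi0 w) 0.

Lemma gain_increment_mono w : nondecreasing_seq (gain_increment ^~ w).
Proof.
move=> m n mn; rewrite /gain_increment ge_max !le_max lexx orbT andbT.
by apply/orP; left; apply: leeB => //; exact: gain_selection_mono.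
Qed.

Lemma measurable_gain_increment n : measurable_fun setT (gain_increment n).
Proof.
apply: measurable_maxe => //; apply: emeasurable_funB; exact: measurable_gain.
Qed.

Definition total_increment w := limn (gain_increment ^~ w).

Lemma measurable_total_increment : measurable_fun setT total_increment.
Proof.
apply: (emeasurable_fun_cvg _ _ measurable_gain_increment) => w _.
exact/ereal_nondecreasing_is_cvgn/gain_increment_mono.
Qed.

Lemma gain_increment_le n w : gain_increment n w <= total_increment w.
Proof.
have /cvg_lim := ereal_nondecreasing_cvgn (gain_increment_mono w).
rewrite /total_increment => ->//.
by apply: ereal_sup_ubound; exists n.
Qed.

(** Every candidate [(q, m)] with [f q <= m] is tried at some stage, so in the
    limit the selection does at least as well as every rational of the domain
    of [f w], hence, by [convex_sup_rat] with [a = xi0 w], as every point of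
    it. *)
Lemma conjugate_tildeE : ae_eq P setT
  (fun w => gain xi0 w + total_increment w)
  (fun w => conjugate_tilde f w (eta w) (density Q w)).
Proof.
have selfin n : {ae P, forall w, gain (selection n) w \is a fin_num /\
    gain (selection n) w <= conjugate_tilde f w (eta w) (density Q w)}.
  have sdom := Drobust_dom gammaP fP (Drobust_selection n).
  by apply: filterS2 (gain_fin_num sdom) (gain_le_conjugate sdom).
have xi0fin := dom_robust_fin_num gammaP fP eta0P conj_eta0P
  (Drobust_dom gammaP fP xi0D).
have selfin_all : {ae P, forall w, forall n, gain (selection n) w \is a fin_num
  /\
    gain (selection n) w <= conjugate_tilde f w (eta w) (density Q w)}.
  exact: ae_foralln selfin.
apply: filterS3 (filterI xi0fin selfin_all) (integrand_convex fP) (density_ge0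
  Q).
move=> w [fxi0 sel] fconv z0 _.
have [gain0 le0] := sel 0%N; rewrite /= in gain0 le0.
apply/eqP; rewrite eq_le; apply/andP; split.
  rewrite -leeBrDl//; apply: lime_le.
    exact/ereal_nondecreasing_is_cvgn/gain_increment_mono.
  apply: nearW => n; rewrite /gain_increment ge_max.
  apply/andP; split; first by rewrite leeB//; have [] := sel n.
  by rewrite leeBrDl// adde0.
have inc0 : 0 <= total_increment w.
  by apply: le_trans (gain_increment_le 0 w); rewrite le_max lexx orbT.
apply: ge_ereal_sup => _ [x fx <-].
apply: (convex_sup_rat fconv (integrand_gtNy fP w) z0 (a := xi0 w)) => //.
- by move: fxi0; rewrite fin_numElt => /andP[].
- by rewrite -/(gain xi0 w) leeDl.
move=> q fq.
pose m := Num.bound `|fine (f w (ratr q))|%R.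
have fm : f w (ratr q) <= m%:R%:E.
  have fqfin : f w (ratr q) \is a fin_num
    by rewrite fin_numElt (integrand_gtNy fP).
  rewrite -(fineK fqfin) lee_fin (le_trans (ler_norm _))//.
  by rewrite ltW// archi_boundP.
have [k kE] := candidate_surj q m.
apply: (le_trans (gain_improve_cst (selection k) fm)).
have -> : improve q m (selection k) = selection k.+1 by rewrite /= kE.
rewrite -leeBlDl//; apply: le_trans (gain_increment_le k.+1 w).
by rewrite le_max lexx.
Qed.

(** As a supremum over uncountably many points, it is measurable only through
    its almost sure equality with a countable limit, [P] being complete. *)
Lemma measurable_conjugate_tilde :
  measurable_fun setT (fun w => conjugate_tilde f w (eta w) (density Q w)).
Proof.
apply: (ae_measurable_fun P_complete conjugate_tildeE).
by apply: emeasurable_funD;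
  [exact: measurable_gain|exact: measurable_total_increment].
Qed.

(** If the gains of all selected elements integrated to at most [c], then by
    monotone convergence so would their limit, the divergence. *)
Lemma f_divergence_approx (c : R) : c%:E < f_divergence f eta Q ->
  exists2 xi, Drobust gamma f xi & c%:E < \int[P]_w gain xi w.
Proof.
move=> cH; apply: contrapT => nsel.
have selc n : \int[P]_w gain (selection n) w <= c%:E.
  rewrite leNgt; apply/negP => h; apply: nsel.
  by exists (selection n); [exact: Drobust_selection|exact: h].
have sdom n := Drobust_dom gammaP fP (Drobust_selection n).
have i0 : P.-integrable setT (gain xi0) by exact: (integrable_gain (sdom 0%N)).
have fin0 : \int[P]_w gain xi0 w \is a fin_num by exact: integrable_fin_num.
have incc n : \int[P]_w gain_increment n w <= c%:E - \int[P]_w gain xi0 w.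
  apply: (@le_trans _ _ (\int[P]_w (gain (selection n) w - gain xi0 w))).
    apply: ae_le_integral; first exact: measurable_gain_increment.
      by apply: emeasurable_funB; exact: measurable_gain.
    apply: filterS (gain_fin_num (sdom 0%N)) => w h.
    rewrite /gain_increment ge_max lexx/= leeBrDl// adde0.
    exact: (gain_selection_mono w (leq0n n)).
  rewrite integralB//; last exact: (integrable_gain (sdom n)).
  by rewrite leeB.
have inc0 n w : 0 <= gain_increment n w by rewrite le_max lexx orbT.
have tot0 w : 0 <= total_increment w by exact: le_trans (gain_increment_le 0 w).
have totc : \int[P]_w total_increment w <= c%:E - \int[P]_w gain xi0 w.
  rewrite (monotone_convergence P measurableT measurable_gain_increment)//.
    apply: lime_le; last exact: nearW.
    apply: ereal_nondecreasing_is_cvgn => m n mn.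
    apply: ge0_le_integral => //; try exact: measurable_gain_increment.
    by move=> w _; exact: gain_increment_mono.
  by move=> w _; exact: gain_increment_mono.
have itot : P.-integrable setT total_increment.
  apply/integrableP; split; first exact: measurable_total_increment.
  under eq_integral do rewrite gee0_abs//.
  apply: (le_lt_trans totc).
  by rewrite -(fineK fin0) -EFinB; exact: ltry.
move: cH; rewrite /f_divergence.
rewrite -(ae_eq_integral _ _ measurableT _ _ conjugate_tildeE); last 2 first.
  by apply: emeasurable_funD;
    [exact: measurable_gain|exact: measurable_total_increment].
  exact: measurable_conjugate_tilde.
rewrite integralD//; apply/negP; rewrite -leNgt addeC -leeBrDr//.
Qed.

Lemma integral_gain_le xi : dom_robust gamma f xi ->
  \int[P]_w gain xi w <= f_divergence f eta Q.
Proof.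
move=> xi_dom; apply: ae_le_integral; first exact: measurable_gain.
  exact: measurable_conjugate_tilde.
exact: gain_le_conjugate.
Qed.

End selection.

(** Replacing [xi] by [zeta] off a large set [A] carrying no mass of [nus]
    changes the integral of the gain little but captures [nus zeta] in full. *)
Lemma paste_approx xi zeta (nus : ba P) (e : R) :
  Drobust gamma f xi -> Drobust gamma f zeta ->
  purely_finitely_additive nus -> (0 < e)%R ->
  exists chi, [/\ Drobust gamma f chi, nus chi = nus zeta &
    \int[P]_w gain xi w <= \int[P]_w gain chi w + e%:E].
Proof.
move=> xiD zetaD [A [mA _ PA1 nusA]] e0.
have xi_dom := Drobust_dom gammaP fP xiD.
have zeta_dom := Drobust_dom gammaP fP zetaD.
pose k w := fine (gain zeta w - gain xi w).
have kE : {ae P, forall w, (k w)%:E = gain zeta w - gain xi w}.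
  apply: filterS2 (gain_fin_num xi_dom) (gain_fin_num zeta_dom) => w h1 h2.
  by rewrite /k fineK// fin_numB h1 h2.
have idiff : P.-integrable setT (fun w => gain zeta w - gain xi w).
  by apply: integrableB => //; exact: integrable_gain.
have mk : measurable_fun setT (EFin \o k).
  apply: (ae_measurable_fun P_complete _ (measurable_int _ idiff)).
  by apply: filterS kE => w h _; rewrite -h.
have ik : P.-integrable setT (EFin \o k).
  apply: (ae_le_integrable mk (integrable_abse idiff)).
  apply: filterS kE => w h.
  by have -> : (EFin \o k) w = gain zeta w - gain xi w by exact: h.
have iak : P.-integrable setT (fun w => `|(k w)%:E|).
  exact: (integrable_abse ik).
have [del [del0 small]] := integral_normr_continuous ik e0.
have [n An] : exists n, P (~` A n) < del%:E.
  move: PA1 => /fine_cvgP[_ /cvgrPdist_lt/(_ del del0)[n _ /(_ n (leqnn n))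
    /=]].
  move=> h; exists n; rewrite probability_setC//.
  have PAfin : P (A n) \is a fin_num by exact: fin_num_measure.
  rewrite -(fineK PAfin) -EFinB lte_fin.
  exact: le_lt_trans (ler_norm _) h.
have mAc : measurable (~` A n) by exact: measurableC.
have chiD := Drobust_paste gammaP fP (mA n) xiD zetaD.
exists (paste (A n) xi zeta); split; first exact: chiD.
  exact: ba_variation0_paste.
have chi_dom := Drobust_dom gammaP fP chiD.
have ikA : P.-integrable setT ((fun w => `|(k w)%:E|) \_ (~` A n)).
  have iakA := integrableS measurableT mAc (@subsetT _ _) iak.
  exact: (integrable_mkcond _ mAc).1 iakA.
apply: (@le_trans _ _ (\int[P]_w (gain (paste (A n) xi zeta) w +
    ((fun w => `|(k w)%:E|) \_ (~` A n)) w))).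
  apply: ae_le_integral; first exact: measurable_gain.
    apply: emeasurable_funD; first exact: measurable_gain.
    exact: measurable_int ikA.
  apply: filterS3 (gain_fin_num xi_dom) (gain_fin_num zeta_dom) kE.
  move=> w h1 h2 h; rewrite /(gain (paste _ _ _)) pasteE// patchE in_setC.
  case: ifP => wA /=; first by rewrite adde0.
  rewrite -/(gain zeta w) -[(`|k w|)%:E]/(`|(k w)%:E|) h.
  rewrite -(fineK h1) -(fineK h2) -EFinB /= -EFinD lee_fin.
  have := ler_norm (- (fine (gain zeta w) - fine (gain xi w)))%R.
  by rewrite normrN; lra.
rewrite integralD//; last exact: integrable_gain.
rewrite leeD2l// -integral_mkcond.
have kfin : \int[P]_(w in ~` A n) `|(k w)%:E| \is a fin_num.
  apply: integrable_fin_num => //.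
  exact: (integrableS measurableT mAc (@subsetT _ _) iak).
rewrite -(fineK kfin) lee_fin ltW//.
exact: small.
Qed.

End fixed_measure.

(** * Exchanging supremum and infimum *)

(** Values below [H] and elements of [S] are tested separately, so that neither
    infinite summand has to be approximated within the sum, where [-oo]
    absorbs. *)
Lemma adde_ereal_sup_le (R : realType) (H Z : \bar R) (S : set (\bar R)) :
  S !=set0 -> (forall y, S y -> y \is a fin_num) ->
  (forall (c : R) y, c%:E < H -> S y -> c%:E + y <= Z) ->
  H + ereal_sup S <= Z.
Proof.
move=> [y0 Sy0] Sfin le; case: Z le => [z| |] le; last 2 first.
- exact: leey.
- case: H le => [h| |] le; last by rewrite addNye.
  + have := le (h - 1)%R y0;
    rewrite lte_fin ltrBlDr ltrDl ltr01 => /(_ isT Sy0).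
    by rewrite -(fineK (Sfin _ Sy0)).
  + have := le 0%R y0 (ltry _) Sy0.
    by rewrite -(fineK (Sfin _ Sy0)).
case: H le => [h| |] le; last by rewrite addNye leNye.
  rewrite -leeBrDl//; apply: ge_ereal_sup => y Sy.
  have [v yE] : exists v, y = v%:E by exists (fine y); rewrite fineK//;
    exact: Sfin.
  rewrite yE in Sy *; rewrite -EFinB lee_fin; apply/ler_addgt0Pr => e e0.
  have := le (h - e)%R v%:E; rewrite lte_fin ltrBlDr ltrDl e0 => /(_ isT Sy).
  by rewrite -EFinD lee_fin; lra.
have := le (z - fine y0 + 1)%R y0 (ltry _) Sy0.
by rewrite -{2}(fineK (Sfin _ Sy0)) -EFinD lee_fin addrAC subrK gerDl ler10.
Qed.

Section duality.
Context d (T : measurableType d) (R : realType) (P : probability T R).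
Hypothesis P_complete : measure_is_complete P.
Variable gamma : acprobability P -> \bar R.
Hypothesis gammaP : is_penalty gamma.
Variable f : T -> R -> \bar R.
Hypothesis fP : normal_convex_integrand P f.
Variable eta0 : T -> R.
Hypothesis eta0P : Lrho gamma (EFin \o eta0).
Hypothesis conj_eta0P : Lrho gamma (fun w => conjugate f w (eta0 w))^\+.
Variable xi0 : Linfty P.
Hypothesis xi0D : Drobust gamma f xi0.
Implicit Types (Q : acprobability P) (xi zeta : Linfty P) (nu : ba P).
Local Notation dom := (dom_penalty gamma).

Let iD xi Q : Drobust gamma f xi -> dom Q ->
  Q.-integrable setT (fun w => f w (xi w)).
Proof.
move=> xiD Qoo; apply: (dom_robust_integrable gammaP fP eta0P conj_eta0P Qoo).
exact: (Drobust_dom gammaP fP).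
Qed.

Let fD xi Q : Drobust gamma f xi -> dom Q ->
  \int[Q]_w f w (xi w) \is a fin_num.
Proof. by move=> xiD Qoo; apply: integrable_fin_num => //; exact: iD. Qed.

(** The robust conjugate at [nu] is at least the supremum over [xi] in
    [Drobust] of the infimum of this function over [Q]. *)
Definition payoff nu xi Q : R :=
  (nu xi - fine (\int[Q]_w f w (xi w)) + fine (gamma Q))%R.

Lemma payoff_concave nu : concavelike (Drobust gamma f) (payoff nu) dom.
Proof.
move=> xi zeta t xiD zetaD t01; have /andP[t0 t1] := t01.
exists (t *: xi + (1 - t) *: zeta)%R; first exact: (Drobust_convex gammaP fP).
move=> Q Qoo; have chiD := Drobust_convex gammaP fP t01 xiD zetaD.
have : \int[Q]_w f w ((t *: xi + (1 - t) *: zeta)%R w) <=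
    t%:E * \int[Q]_w f w (xi w) + (1 - t)%:E * \int[Q]_w f w (zeta w).
  rewrite -!integralZl//; [|exact: iD..].
  rewrite -integralD//; [|by apply: integrableZl => //; exact: iD..].
  apply: ae_le_integral; first exact: (measurable_integrand fP).
    apply: emeasurable_funD; apply: emeasurable_funM => //;
    exact: (measurable_integrand fP).
  apply: (ac_ae Q); apply: filterS (integrand_convex fP) => w h.
  by rewrite LinftyDE !LinftyZE; exact: h.
rewrite -(fineK (fD chiD Qoo)) -(fineK (fD xiD Qoo)) -(fineK (fD zetaD Qoo)).
rewrite -!EFinM -EFinD lee_fin /payoff ba_linear linearZ/= => h.
by move: h; set A := fine _; set B := fine _; set C := fine _; lra.
Qed.

Lemma payoff_convex nu : convexlike (Drobust gamma f) (payoff nu) dom.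
Proof.
move=> Q0 Q1 t Q0oo Q1oo t01; have /andP[t0 t1] := t01.
have [Q Qt] := mixture_exists Q0 Q1 t01.
have gQ : gamma Q <= (t * fine (gamma Q0) + (1 - t) * fine (gamma Q1))%:E.
  rewrite EFinD !EFinM !fineK ?(penalty_fin_num gammaP)//.
  exact: (@penalty_convex _ _ _ _ _ gammaP _ _ _ _ t01 Qt).
have Qoo : dom Q by apply: le_lt_trans gQ (ltry _).
exists Q => // xi xiD; rewrite /payoff.
have -> : fine (\int[Q]_w f w (xi w)) = (t * fine (\int[Q0]_w f w (xi w)) +
    (1 - t) * fine (\int[Q1]_w f w (xi w)))%R.
  apply: EFin_inj; rewrite EFinD !EFinM !fineK ?fD//.
  by rewrite (integral_mixture t01 Qt)//; exact: iD.
move: gQ; rewrite -{1}(fineK (penalty_fin_num gammaP Qoo)) lee_fin => gQ.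
by nra.
Qed.

(** By the tail estimate, [E_Q[f(xi0)]] grows at most like [gamma(Q) / 2]. *)
Lemma payoff_coercive nu (c : R) : exists c1 : R, forall Q, dom Q ->
  (payoff nu xi0 Q <= c)%R -> gamma Q <= c1%:E.
Proof.
have /(DrobustP gammaP fP)[_ t0] := xi0D.
have mf : measurable_fun setT (fun w => f w (xi0 w)).
  exact: (measurable_integrand fP).
have half0 : (0 < 2^-1 :> R)%R by rewrite invr_gt0.
have [N fN] := integral_funepos_tail mf t0 half0.
exists (2 * (c - nu xi0 + 2^-1 + N%:R))%R => Q Qoo.
have : \int[Q]_w f w (xi0 w) <= 2^-1%:E * (1 + gamma Q) + N%:R%:E.
  apply: le_trans (fN Q Qoo); apply: ae_le_integral => //.
    exact: measurable_funepos.
  by apply: nearW => w; rewrite funeposE le_max lexx.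
rewrite /payoff -(fineK (fD xi0D Qoo)) -(fineK (penalty_fin_num gammaP Qoo)) /=.
rewrite -EFinD -?EFinM -?EFinD !lee_fin.
by set A := fine _; set B := fine _; lra.
Qed.

Lemma payoff_lsc nu (c1 c : R) xi Q : Drobust gamma f xi ->
  gamma Q <= c1%:E -> (c < payoff nu xi Q)%R ->
  nbhs (Q : weak_acprobability P)
    [set Q' | gamma Q' <= c1%:E -> (c < payoff nu xi Q')%R].
Proof.
move=> xiD Qc1; rewrite /payoff.
have cdom Q' : gamma Q' <= c1%:E -> dom Q' by move=> /le_lt_trans; apply;
  exact: ltry.
have Qoo := cdom _ Qc1.
set A := fine (\int[Q]_w _); set B := fine (gamma Q) => cF.
pose del := ((nu xi - A + B - c) / 2)%R.
have del0 : (0 < del)%R by rewrite divr_gt0// subr_gt0.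
have dE : (nu xi - A + B = c + 2 * del)%R by rewrite /del; field.
have /(DrobustP gammaP fP)[_ txi] := xiD.
have mf : measurable_fun setT (fun w => f w (xi w)).
  exact: (measurable_integrand fP).
have intA : \int[Q]_w f w (xi w) < (A + del)%:E.
  by rewrite -(fineK (fD xiD Qoo)) lte_fin ltrDl.
have gamB : (B - del)%:E < gamma Q.
  by rewrite -(fineK (penalty_fin_num gammaP Qoo)) lte_fin ltrBlDr ltrDl.
have n1 := integral_usc gammaP txi mf (fun Q' => iD xiD) Qc1 intA.
have [V QV Vg] := (penalty_lsc gammaP : lower_semicontinuous _) Q _ gamB.
apply: filterS2 n1 QV => Q' /= h1 /Vg h2 Q'c1.
have Q'oo := cdom _ Q'c1; have {}h1 := h1 Q'c1.
rewrite -(fineK (fD xiD Q'oo)) lte_fin in h1.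
rewrite -(fineK (penalty_fin_num gammaP Q'oo)) lte_fin in h2.
by clearbody del A B; lra.
Qed.

(** A lower bound on the payoff of one [xi], uniform in [Q], is a lower bound
    on [nu(xi)] minus the robust integral of [xi]. *)
Lemma robust_minimax nu (c' c : R) : (c' < c)%R ->
  (forall Q, dom Q -> exists2 xi, Drobust gamma f xi & (c < payoff nu xi Q)%R)
    ->
  c'%:E <= robust_conjugate gamma f nu.
Proof.
move=> c'c sup; have [c1 coerc] := payoff_coercive nu c.
have cdom Q' : gamma Q' <= c1%:E -> dom Q' by move=> /le_lt_trans; apply;
  exact: ltry.
have [xi xiD le] := @minimax_compact R (weak_acprobability P) (Linfty P)
    (Drobust gamma f) (payoff nu) dom [set Q | gamma Q <= c1%:E] xi0 c' c
    (@payoff_convex nu) (@payoff_concave nu) xi0D (compact_sublevel gammaP (c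
      := c1))
    (fun Q h => coerc Q h.1 h.2) cdom
    (fun xi Q xiD Qc => payoff_lsc xiD Qc) sup c'c.
have I_le : robust_integral gamma f xi <= (nu xi - c')%:E.
  apply: ge_ereal_sup => _ [Q Qoo <-].
  have := le Q Qoo; rewrite /payoff.
  rewrite -(fineK (fD xiD Qoo)) -(fineK (penalty_fin_num gammaP Qoo)) /=.
  by rewrite -EFinB lee_fin; set A := fine _; set B := fine _; lra.
apply: (@le_trans _ _ ((nu xi)%:E - robust_integral gamma f xi)).
  rewrite (_ : c'%:E = (nu xi)%:E - (nu xi - c')%:E); first exact: leeB.
  by rewrite -EFinB subKr.
by apply: ereal_sup_ubound; exists xi.
Qed.

Section decomposition.
Variables (nu nur nus : ba P) (snur : ba_sigma_additive nur).
Hypothesis nuE : yosida_hewitt nu nur nus.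
Local Notation eta := (ba_density snur).

Let ieta : P.-integrable setT (EFin \o eta) := integrable_ba_density snur.

Let integral_gainE xi Q : dom_robust gamma f xi -> dom Q ->
  \int[P]_w gain f eta Q xi w = (nur xi)%:E - \int[Q]_w f w (xi w).
Proof.
move=> xi_dom Qoo.
by rewrite (integral_gain gammaP fP eta0P conj_eta0P ieta Qoo xi_dom)
  ba_sigma_additiveE.
Qed.

(** For each [Q], an element whose gain integrates to nearly the divergence is
    pasted with [zeta], at a total payoff of nearly the divergence plus
    [nus(zeta)] plus [gamma(Q)]; [robust_minimax] makes the choice uniform in
    [Q]. *)
Lemma robust_conjugate_ge :
  robust_f_divergence gamma f eta +
    ereal_sup [set (nus xi)%:E | xi in Drobust gamma f]
  <= robust_conjugate gamma f nu.
Proof.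
have [nuD _ nusP] := nuE.
apply: adde_ereal_sup_le; first by exists (nus xi0)%:E, xi0.
  by move=> _ [xi _ <-].
move=> c _ cH [zeta zetaD <-]; apply/lee_addgt0Pr => e e0.
rewrite -leeBlDr// -EFinD -?EFinB.
apply: (@robust_minimax nu _ (c + nus zeta - e / 2)%R); first by lra.
move=> Q Qoo; pose g := fine (gamma Q).
have gE : gamma Q = g%:E by rewrite fineK// (penalty_fin_num gammaP).
have cdiv : (c - g)%:E < f_divergence f eta Q.
  rewrite EFinB lteBlDr// -gE; apply: (lt_le_trans cH).
  by apply: ereal_inf_lbound; exists Q.
have [xi xiD cxi] := f_divergence_approx P_complete gammaP fP eta0P conj_eta0P
  ieta Qoo xi0D cdiv.
have e20 : (0 < e / 2)%R by rewrite divr_gt0.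
have [chi [chiD nuschi le]]
  := paste_approx P_complete gammaP fP eta0P conj_eta0P
  ieta Qoo xiD zetaD nusP e20.
exists chi; first exact: chiD.
have := lt_le_trans cxi le.
rewrite (integral_gainE (Drobust_dom gammaP fP chiD) Qoo).
rewrite -(fineK (fD chiD Qoo)) -EFinB -EFinD lte_fin /payoff nuD nuschi -/g.
by set A := fine _; lra.
Qed.

(** [E_Q[f(xi)] - gamma(Q)] is at most the robust integral for every [Q], so
    any [Q] bounds [nur(xi)] minus the robust integral by its divergence plus
    its penalty. *)
Lemma robust_conjugate_le :
  robust_conjugate gamma f nu <=
  robust_f_divergence gamma f eta +
    ereal_sup [set (nus xi)%:E | xi in dom_robust gamma f].
Proof.
have [nuD _ _] := nuE.
apply: ge_ereal_sup => _ [xi _ <-].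
have [xi_dom|] := pselect (dom_robust gamma f xi); last first.
  move=> /negP; rewrite -leNgt leye_eq => /eqP ->.
  by rewrite addeNy leNye.
apply: (@le_trans _ _ (robust_f_divergence gamma f eta + (nus xi)%:E));
  last first.
  by rewrite leeD2l//; apply: ereal_sup_ubound; exists xi.
rewrite nuD EFinD addeAC leeD2r//.
apply: le_ereal_inf_tmp => _ [Q Qoo <-].
apply: (@le_trans _ _ (\int[P]_w gain f eta Q xi w + gamma Q)); last first.
  rewrite leeD2r//.
  exact: (integral_gain_le P_complete gammaP fP eta0P conj_eta0P ieta Q xi0D
    xi_dom).
rewrite (integral_gainE xi_dom Qoo).
have fQ : \int[Q]_w f w (xi w) \is a fin_num.
  apply: integrable_fin_num => //.
  exact: (dom_robust_integrable gammaP fP eta0P conj_eta0P Qoo xi_dom).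
have := rho_ge (fun w => f w (xi w)) Qoo;
  rewrite -/(robust_integral gamma f xi).
rewrite -(fineK fQ) -(fineK (penalty_fin_num gammaP Qoo)).
rewrite -!EFinB -EFinD => h.
apply: (le_trans (leeB (lexx _) h)).
by rewrite -EFinB lee_fin opprB addrA addrAC lexx.
Qed.

End decomposition.
End duality.

Theorem theorem3p1 (d : measure_display) (T : measurableType d) (R : realType)
    (P : probability T R) (P_complete : measure_is_complete P)
    (gamma : acprobability P -> \bar R) (gamma_penalty : is_penalty gamma)
    (f : T -> R -> \bar R) (f_normal : normal_convex_integrand P f)
    (eta0_ex : exists eta0 : T -> R, Lrho gamma (EFin \o eta0) /\
       Lrho gamma ((fun w => conjugate f w (eta0 w))^\+))
    (xi0_ex : exists xi0 : Linfty P,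
       Mrhou gamma ((fun w => f w (xi0 w))^\+)) :
  Drobust gamma f `<=` dom_robust gamma f /\
  forall (nu nur nus : ba P) (nur_sigma : ba_sigma_additive nur),
    yosida_hewitt nu nur nus ->
    robust_f_divergence gamma f (ba_density nur_sigma) +
        ereal_sup [set (nus xi)%:E | xi in Drobust gamma f]
      <= robust_conjugate gamma f nu /\
    robust_conjugate gamma f nu
      <= robust_f_divergence gamma f (ba_density nur_sigma) +
        ereal_sup [set (nus xi)%:E | xi in dom_robust gamma f].
Proof.
have [eta0 [eta0P conjP]] := eta0_ex; have [xi0 xi0D] := xi0_ex.
split; first exact: (Drobust_dom gamma_penalty f_normal).
move=> nu nur nus snur nuE; split.
  exact: (robust_conjugate_ge P_complete gamma_penalty f_normal eta0P conjP xi0D).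
exact: (robust_conjugate_le P_complete gamma_penalty f_normal eta0P conjP xi0D).
Qed.
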